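(* Let $\mathbb G$ be a Carnot group with a fixed sub-Laplacian $\mathcal L$, let $N$ be a continuous proper homogeneous gauge on $\mathbb G$, and let $\sigma_N$ be its dilation-polar measure on $S_N=\{N=1\}$. Then $$\mathscr H_N=\widehat{\bigoplus_{m=0}^{\infty}}\mathcal K_m^N,\qquad \dim\mathcal K_m^N=\dim H_m(\mathbb G)\quad(m\ge0).$$ This is a decomposition of $L^2(S_N,\sigma_N)$ if and only if the harmonic-density condition $\mathscr H_N=L^2(S_N,\sigma_N)$ holds. By contrast, without any additional assumption, $$L^2(S_N,\sigma_N)=\widehat{\bigoplus_{m=0}^{\infty}}\mathscr W_m^N.$$ Here $\widehat\bigoplus$ denotes an orthogonal Hilbert direct sum.
   Context: $\mathbb G$ is a connected, simply connected Carnot group with stratified Lie algebra $\mathfrak g=V_1\oplus\cdots\oplus V_s$, $[V_1,V_j]=V_{j+1}$ for $1\le j<s$, $[V_1,V_s]=\{0\}$; $d_j=\dim V_j$ and $Q=\sum_j jd_j$. Exponential coordinates $x=(x_{j,k})$ ($1\le j\le s$, $1\le k\le d_j$) adapted to the stratification are fixed, with dilations $\delta_r(x_{j,k})=(r^jx_{j,k})$, $r>0$. With complex coefficients, $P_m(\mathbb G)$ is the space of coordinate polynomials $p$ with $p\circ\delta_r=r^mp$ for all $r>0$ ($\{0\}$ if $m<0$). $\mathcal L=\sum_{a=1}^{d_1}X_a^2$, where $X_1,\dots,X_{d_1}$ are the left-invariant vector fields corresponding to a basis of $V_1$, and $H_m(\mathbb G)=\ker(\mathcal L|_{P_m(\mathbb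 G)})$. A continuous proper homogeneous gauge is a continuous proper function $N:\mathbb G\to[0,\infty)$ with $N(e)=0$, $N(x)>0$ for $x\ne e$, $N(\delta_rx)=rN(x)$. Its dilation-polar measure $\sigma_N$ is the finite Radon measure on $S_N=\{N=1\}$ with $\int_{\mathbb G}f\,dx=\int_0^\infty\int_{S_N}f(\delta_r\omega)\,d\sigma_N(\omega)\,r^{Q-1}dr$ for $f\in C_c(\mathbb G\setminus\{e\})$, $dx$ being Haar measure. $H_m(S_N)=\{h|_{S_N}:h\in H_m(\mathbb G)\}$; $\mathcal E_{-1}^N=\{0\}$, $\mathcal E_m^N=\sum_{j=0}^mH_j(S_N)$ (an algebraic direct sum), $\mathcal K_m^N=\mathcal E_m^N\cap(\mathcal E_{m-1}^N)^\perp$, and $\mathscr H_N$ is the closure of $\bigcup_{m\ge0}\mathcal E_m^N$ in $L^2(S_N,\sigma_N)$. $\mathscr A_m=\bigoplus_{j=0}^mP_j(\mathbb G)$, $\mathscr V_m^N=\{p|_{S_N}:p\in\mathscr A_m\}$, $\mathscr V_{-1}^N=\{0\}$, $\mathscr W_m^N=\mathscr V_m^N\cap(\mathscr V_{m-1}^N)^\perp$. Orthogonal complements are in (complex) $L^2(S_N,\sigma_N)$. *)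

(* Defs.v *)
From HB Require Import structures.
From mathcomp Require Import all_boot all_order all_algebra.
From mathcomp Require Import complex.
From mathcomp Require mpoly.
From mathcomp Require Import all_classical all_reals all_analysis.

Set Implicit Arguments.
Unset Strict Implicit.
Unset Printing Implicit Defensive.

Import Order.TTheory GRing.Theory Num.Theory numFieldNormedType.Exports.

Local Open Scope classical_set_scope.
Local Open Scope ring_scope.

Section LieGroupOnRn.
Context {R : realType} {n : nat}.
Implicit Types (mul : 'rV[R]_n -> 'rV[R]_n -> 'rV[R]_n) (u v x : 'rV[R]_n).

(* Class C^k, through Frechet differentiability and directional derivatives. *)
Fixpoint class_C (k : nat) (f : 'rV[R]_n -> R) : Prop :=
  if k is k'.+1 then
    (forall x, differentiable f x) /\ (forall v, class_C k' (fun x => 'D_v f x))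
  else continuous f.

Definition smooth (f : 'rV[R]_n -> R) : Prop := forall k, class_C k f.

(* The left-invariant vector field with value u at the identity; the curve
   t |-> t *: u is the one-parameter group of u in exponential coordinates. *)
Definition lvf mul u (f : 'rV[R]_n -> R) : 'rV[R]_n -> R :=
  fun x => derive1 (fun t : R => f (mul x (t *: u))) 0.

(* The value at the identity, in coordinates, of the commutator of the
   left-invariant vector fields of u and v. *)
Definition lie_bracket mul u v : 'rV[R]_n :=
  \row_i (lvf mul u (lvf mul v (fun x => x 0 i)) 0
          - lvf mul v (lvf mul u (fun x => x 0 i)) 0).

Variable wt : 'I_n -> nat.

Definition wlayer (j : nat) : set 'rV[R]_n :=
  [set x | forall i, wt i != j -> x 0 i = 0].

Definition wdil (r : R) (x : 'rV[R]_n) : 'rV[R]_n := \row_i (r ^+ wt i * x 0 i).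

End LieGroupOnRn.

(* A connected, simply connected Carnot group, read in exponential coordinates
   adapted to the stratification: the manifold is R^n, the Lie algebra is R^n
   with [lie_bracket], and exp is the identity map ([cg_exp]).  The coordinates
   x_{j,k} are indexed by 'I_n, and [cg_wt i] is the layer j of the i-th one.
   The inverse of x is - x, by [cg_exp].  [cg_dilM] says that the dilations,
   which the grading makes automorphisms of the Lie algebra, are automorphisms
   of the group. *)
Record carnotGroup (R : realType) := CarnotGroup {
  cg_dim : nat ;
  cg_step : nat ;
  cg_wt : 'I_cg_dim -> nat ;
  cg_mul : 'rV[R]_cg_dim -> 'rV[R]_cg_dim -> 'rV[R]_cg_dim ;
  cg_wt_range : forall i, (0 < cg_wt i <= cg_step)%N ;
  cg_V1_neq0 : exists i, cg_wt i = 1%N ;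
  cg_mulA : forall x y z, cg_mul x (cg_mul y z) = cg_mul (cg_mul x y) z ;
  cg_mul0x : forall x, cg_mul 0 x = x ;
  cg_mulx0 : forall x, cg_mul x 0 = x ;
  cg_mul_smooth : forall i,
    smooth (fun z : 'rV[R]_(cg_dim + cg_dim) => cg_mul (lsubmx z) (rsubmx z) 0 i) ;
  cg_exp : forall x (s t : R), cg_mul (s *: x) (t *: x) = (s + t) *: x ;
  cg_strat : forall j, (0 < j < cg_step)%N ->
    wlayer cg_wt j.+1 =
      [set x | exists (k : nat) (u v : 'I_k -> 'rV[R]_cg_dim),
        [/\ forall a, wlayer cg_wt 1 (u a), forall a, wlayer cg_wt j (v a) &
            x = \sum_(a < k) lie_bracket cg_mul (u a) (v a)]] ;
  cg_strat_top : forall u v,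
    wlayer cg_wt 1 u -> wlayer cg_wt cg_step v -> lie_bracket cg_mul u v = 0 ;
  cg_dilM : forall (r : R) x y, 0 < r ->
    wdil cg_wt r (cg_mul x y) = cg_mul (wdil cg_wt r x) (wdil cg_wt r y)
}.

Arguments cg_dim {R}.
Arguments cg_step {R}.
Arguments cg_wt {R}.
Arguments cg_mul {R}.

Section CarnotNotions.
Context {R : realType} (G : carnotGroup R).

Definition pt := 'rV[R]_(cg_dim G).

Definition borel : measurableType (@open 'rV[R]_(cg_dim G)).-sigma :=
  g_sigma_algebraType (@open 'rV[R]_(cg_dim G)).

Definition layer (j : nat) : set pt := wlayer (cg_wt G) j.

Definition dil (r : R) (x : pt) : pt := wdil (cg_wt G) r x.

Definition layer_dim (j : nat) : nat := #|[pred i | cg_wt G i == j]|.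

Definition hom_dim : nat := (\sum_(1 <= j < (cg_step G).+1) j * layer_dim j)%N.

(* The rows of X form a basis of V_1. *)
Definition basis_V1 (X : 'M[R]_(layer_dim 1, cg_dim G)) : Prop :=
  row_free X /\ forall v : pt, layer 1 v <-> (v <= X)%MS.

Definition lvfC (u : pt) (f : pt -> R[i]) : pt -> R[i] := fun x =>
  Complex (lvf (cg_mul G) u (fun y => complex.Re (f y)) x)
          (lvf (cg_mul G) u (fun y => complex.Im (f y)) x).

Definition sublaplacian (X : 'M[R]_(layer_dim 1, cg_dim G)) (f : pt -> R[i]) :
    pt -> R[i] :=
  fun x => \sum_a lvfC (row a X) (lvfC (row a X) f) x.

Definition polynomial_fun (p : pt -> R[i]) : Prop :=
  exists q : mpoly.mpoly (cg_dim G) R[i],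
    p = fun x => mpoly.meval (fun i => Complex (x 0 i) 0) q.

Definition Pm (m : nat) : set (pt -> R[i]) :=
  [set p | polynomial_fun p /\
           forall (r : R) x, 0 < r -> p (dil r x) = Complex (r ^+ m) 0 * p x].

Definition Hm (X : 'M[R]_(layer_dim 1, cg_dim G)) (m : nat) : set (pt -> R[i]) :=
  [set p | Pm m p /\ sublaplacian X p = (fun _ => 0)].

(* On R^n a Borel measure that is finite on compact sets is a Radon measure. *)
Definition haar (mu : {measure set borel -> \bar R}) : Prop :=
  [/\ forall K : set pt, compact K -> (mu K < +oo)%E,
      mu setT <> 0%E &
      forall (x : pt) (A : set borel), measurable A ->
        mu (cg_mul G x @` A) = mu A].

Definition gauge (N : pt -> R) : Prop :=
  [/\ continuous N,
      forall K : set R, compact K -> compact (N @^-1` K),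
      N 0 = 0,
      forall x, x != 0 -> 0 < N x &
      forall (r : R) x, 0 < r -> N (dil r x) = r * N x].

Definition sphere (N : pt -> R) : set pt := [set x | N x = 1].

(* A measure on S_N is encoded as a measure on G that S_N carries. *)
Definition polar_measure (mu : {measure set borel -> \bar R}) (N : pt -> R)
    (sigma : {finite_measure set borel -> \bar R}) : Prop :=
  sigma (~` sphere N) = 0%E /\
  forall f : pt -> R, continuous f ->
    (exists K : set pt, [/\ compact K, ~ K 0 & forall x, ~ K x -> f x = 0]) ->
    (\int[mu]_x (f x)%:E =
     \int[lebesgue_measure]_(r in `]0%R, +oo[%classic)
       ((\int[sigma]_(w in sphere N) (f (dil r w))%:E)
          * (r ^+ hom_dim.-1)%:E))%E.

End CarnotNotions.

Section FunctionSpaces.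
Context {R : realType} {T : Type}.
Implicit Types (A : nat -> set (T -> R[i])) (Z V : set (T -> R[i])).

(* A 0 + ... + A (k - 1); it is {0} for k = 0. *)
Definition psum A (k : nat) : set (T -> R[i]) :=
  [set f | exists g : nat -> T -> R[i],
    (forall j, (j < k)%N -> A j (g j)) /\ f = fun x => \sum_(j < k) g j x].

Definition subspace V : Prop :=
  V (fun _ => 0) /\
  forall (a : R[i]) f g, V f -> V g -> V (fun x => a * f x + g x).

(* The space V, taken modulo the null functions Z, has dimension k. *)
Definition has_dim Z V (k : nat) : Prop :=
  exists b : 'I_k -> T -> R[i],
    [/\ forall i, V (b i),
        forall c : 'I_k -> R[i],
          Z (fun x => \sum_i c i * b i x) -> forall i, c i = 0 &
        forall f, V f -> exists c : 'I_k -> R[i],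
          Z (fun x => f x - \sum_i c i * b i x)].

End FunctionSpaces.

(* Vectors of the complex space L^2(mu) are represented by functions, and the
   equality of vectors is equality mu-almost everywhere; a subspace of L^2(mu)
   is represented by the set of all representatives of its elements. *)
Section ComplexL2.
Context d (T : measurableType d) (R : realType) (mu : {measure set T -> \bar R}).
Implicit Types (f g : T -> R[i]) (A : set (T -> R[i])).

Definition normsq (z : R[i]) : R := complex.Re z ^+ 2 + complex.Im z ^+ 2.

Definition L2 : set (T -> R[i]) :=
  [set f | [/\ measurable_fun setT (fun x => complex.Re (f x)),
               measurable_fun setT (fun x => complex.Im (f x)) &
               (\int[mu]_x (normsq (f x))%:E < +oo)%E]].

Definition inner f g : R[i] :=
  Complex (Rintegral mu setT (fun x => complex.Re (f x * conjc (g x))))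
          (Rintegral mu setT (fun x => complex.Im (f x * conjc (g x)))).

Definition L2norm f : R := Num.sqrt (Rintegral mu setT (fun x => normsq (f x))).

Definition ae0 : set (T -> R[i]) := [set f | {ae mu, forall x, f x = 0}].

Definition orth A : set (T -> R[i]) :=
  [set f | L2 f /\ forall g, A g -> inner f g = 0].

Definition L2closure A : set (T -> R[i]) :=
  [set f | L2 f /\ forall e : R, 0 < e ->
    exists g, [/\ A g, L2 g & L2norm (fun x => f x - g x) < e]].

(* H is the orthogonal Hilbert direct sum of its closed subspaces K m. *)
Definition hilbert_sum (H : set (T -> R[i])) (K : nat -> set (T -> R[i])) : Prop :=
  [/\ forall m, subspace (K m) /\ L2closure (K m) = K m,
      forall m p f g, m <> p -> K m f -> K p g -> inner f g = 0 &
      H = L2closure (\bigcup_k psum K k)].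

(* The elements of L^2(mu) that are restrictions to S of elements of A. *)
Definition restr (S : set T) A : set (T -> R[i]) :=
  [set f | L2 f /\ exists2 p, A p & {ae mu, forall x, S x -> f x = p x}].

End ComplexL2.

Section Spaces.
Context {R : realType} (G : carnotGroup R) (N : pt G -> R)
        (sigma : {finite_measure set (borel G) -> \bar R}).

(* The indices of Espace and Vspace are shifted by one, to start from -1:
   Espace k is E_{k-1} and Vspace k is V_{k-1}. *)
Definition Espace (X : 'M[R]_(layer_dim G 1, cg_dim G)) (k : nat) :
    set (borel G -> R[i]) :=
  psum (fun j => restr sigma (sphere N) (Hm X j)) k.

Definition Kspace X (m : nat) : set (borel G -> R[i]) :=
  Espace X m.+1 `&` orth sigma (Espace X m).

Definition HNspace X : set (borel G -> R[i]) :=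
  L2closure sigma (\bigcup_m Espace X m.+1).

Definition Vspace (k : nat) : set (borel G -> R[i]) :=
  restr sigma (sphere N) (psum (@Pm R G) k).

Definition Wspace (m : nat) : set (borel G -> R[i]) :=
  Vspace m.+1 `&` orth sigma (Vspace m).

End Spaces.

(* Main.v *)
Require Import Defs.
From mathcomp Require Import all_boot all_order all_algebra.
From mathcomp Require Import complex.
From mathcomp Require mpoly.
From mathcomp Require Import all_classical all_reals all_analysis.
From mathcomp Require Import measurable_realfun.
From mathcomp Require Import ring lra.
Import Defs.
Import Order.TTheory GRing.Theory Num.Theory numFieldNormedType.Exports.
Set Implicit Arguments.
Unset Strict Implicit.
Unset Printing Implicit Defensive.
Import (canonicals, coercions) mpoly.
Import HBSimple HBNNSimple.

(** Both decompositions orthogonalize an increasing sequence of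
    finite-dimensional subspaces of L2: the sums of the restrictions to the
    sphere of homogeneous harmonic polynomials, or of all homogeneous
    polynomials. An element of one step is its projection onto the previous step
    plus an element of the increment, so the increments have the whole union as
    their algebraic sum, and they are orthogonal and closed
    ([hilbert_sum_filtration]). The first decomposition follows at once, and so
    does the equivalence with harmonic density. Two points remain.

    The dimension of an increment is that of H_m because the sum of the H_j stays
    direct on the sphere, modulo sigma-null functions ([Hm_direct_ae]). Let a sum
    h of elements h_j of H_j be null on the sphere. The polar formula and the
    positivity of Haar measure on open sets show that sigma charges every
    nonempty open part of the sphere ([polar_full_support]), so h vanishes on the
    whole sphere. As h is harmonic, it then vanishes on the unit ball of the
    gauge ([harmonic_eq0]); the weak maximum principle is enough for this, and it
    is elementary because the square of a coordinate x_i of the first layer has a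
    positive constant sub-Laplacian ([weak_maximum_principle]). The reason is that
    X_a x_i is constant: it is continuous and invariant under dilations
    ([lvf_coord]). Finally h (dil r x) is a polynomial in r with coefficients
    h_j x, which vanishes for small r, so each h_j is 0 ([Hm_direct_sphere]).

    The second decomposition exhausts L2 because polynomials are dense
    ([polynomial_dense]). The polynomials (1 - y ^ k) ^ (k * 2 ^ k) stay between
    0 and 1 on the unit interval and tend pointwise to the indicator of y < 1/2.
    Composed with affine functions of polynomials, they approximate the sets
    where a polynomial is negative, hence all boxes. A Dynkin system argument
    reaches all Borel sets, and simple functions reach all of L2. *)

Local Open Scope classical_set_scope.
Local Open Scope ring_scope.

(** * Real and imaginary parts *)

Section ComplexParts.
Variable R : realType.
Implicit Types a b z : R[i].

Lemma ReD a b : complex.Re (a + b) = complex.Re a + complex.Re b.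
Proof. by case: a; case: b. Qed.
Lemma ImD a b : complex.Im (a + b) = complex.Im a + complex.Im b.
Proof. by case: a; case: b. Qed.
Lemma ReN a : complex.Re (- a) = - complex.Re a.
Proof. by case: a. Qed.
Lemma ImN a : complex.Im (- a) = - complex.Im a.
Proof. by case: a. Qed.
Lemma ReM a b :
  complex.Re (a * b) = complex.Re a * complex.Re b - complex.Im a * complex.Im b.
Proof. by case: a; case: b. Qed.
Lemma ImM a b :
  complex.Im (a * b) = complex.Re a * complex.Im b + complex.Im a * complex.Re b.
Proof. by case: a; case: b. Qed.
Lemma ReJ a : complex.Re (conjc a) = complex.Re a.
Proof. by case: a. Qed.
Lemma ImJ a : complex.Im (conjc a) = - complex.Im a.
Proof. by case: a. Qed.
Lemma complexP a b :
  complex.Re a = complex.Re b -> complex.Im a = complex.Im b -> a = b.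
Proof. by case: a b => [a1 a2] [b1 b2] /= -> ->. Qed.

Lemma Re_sum I (r : seq I) (F : I -> R[i]) :
  complex.Re (\sum_(i <- r) F i) = \sum_(i <- r) complex.Re (F i).
Proof. by elim/big_rec2: _ => // i x y _ <-; rewrite ReD. Qed.
Lemma Im_sum I (r : seq I) (F : I -> R[i]) :
  complex.Im (\sum_(i <- r) F i) = \sum_(i <- r) complex.Im (F i).
Proof. by elim/big_rec2: _ => // i x y _ <-; rewrite ImD. Qed.

Definition partsE := (ReD, ImD, ReN, ImN, ReM, ImM, ReJ, ImJ).

Lemma normsq_ge0 z : 0 <= normsq z.
Proof. by rewrite addr_ge0 ?sqr_ge0. Qed.
Lemma normsq0 : normsq (0 : R[i]) = 0.
Proof. by rewrite /normsq /= expr0n /= addr0. Qed.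
Lemma normsq_eq0 z : normsq z = 0 -> z = 0.
Proof.
rewrite /normsq => /eqP; rewrite paddr_eq0 ?sqr_ge0// !sqrf_eq0.
by move=> /andP[/eqP a /eqP b]; apply: complexP.
Qed.
Lemma normsqD a b : normsq (a + b) <= 2 * normsq a + 2 * normsq b.
Proof.
rewrite /normsq !partsE; set x := complex.Re a; set y := complex.Im a.
set u := complex.Re b; set v := complex.Im b.
have := sqr_ge0 (x - u); have := sqr_ge0 (y - v); rewrite !expr2; nra.
Qed.
Lemma normsqM a b : normsq (a * b) = normsq a * normsq b.
Proof. by rewrite /normsq !partsE; ring. Qed.
Lemma normsqN a : normsq (- a) = normsq a.
Proof. by rewrite /normsq !partsE !sqrrN. Qed.
(** With its analogue for imaginary parts, this makes f * conj g integrable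
    for f and g in L2. *)
Lemma Re_mulJ a b : `|complex.Re (a * conjc b)| <= normsq a + normsq b.
Proof.
rewrite /normsq !partsE; set x := complex.Re a; set y := complex.Im a.
set u := complex.Re b; set v := complex.Im b.
have h1 := sqr_ge0 (x - u); have h2 := sqr_ge0 (y - v).
have h3 := sqr_ge0 (x + u); have h4 := sqr_ge0 (y + v).
have h5 := sqr_ge0 x; have h6 := sqr_ge0 y.
have h7 := sqr_ge0 u; have h8 := sqr_ge0 v.
by rewrite ler_norml; apply/andP; split; rewrite !expr2 in h1 h2 h3 h4 h5 h6 h7 h8 *; nra.
Qed.
Lemma Im_mulJ a b : `|complex.Im (a * conjc b)| <= normsq a + normsq b.
Proof.
rewrite /normsq !partsE; set x := complex.Re a; set y := complex.Im a.
set u := complex.Re b; set v := complex.Im b.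
have h1 := sqr_ge0 (x - v); have h2 := sqr_ge0 (y - u).
have h3 := sqr_ge0 (x + v); have h4 := sqr_ge0 (y + u).
have h5 := sqr_ge0 x; have h6 := sqr_ge0 y.
have h7 := sqr_ge0 u; have h8 := sqr_ge0 v.
by rewrite ler_norml; apply/andP; split; rewrite !expr2 in h1 h2 h3 h4 h5 h6 h7 h8 *; nra.
Qed.
End ComplexParts.

Section Subspaces.
Context {R : realType} {T : Type}.
Implicit Types (f g : T -> R[i]) (V : set (T -> R[i])).

Lemma subspaceD V f g : subspace V -> V f -> V g -> V (fun x => f x + g x).
Proof.
case=> _ VL Vf Vg; have := VL 1 f g Vf Vg.
by congr V; apply/funext => x; rewrite mul1r.
Qed.
Lemma subspaceZ V a f : subspace V -> V f -> V (fun x => a * f x).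
Proof.
case=> V0 VL Vf; have := VL a f _ Vf V0.
by congr V; apply/funext => x; rewrite addr0.
Qed.
Lemma subspaceB V f g : subspace V -> V f -> V g -> V (fun x => f x - g x).
Proof.
move=> sV Vf Vg; have := sV.2 (-1) g f Vg Vf.
by congr V; apply/funext => x; rewrite mulN1r addrC.
Qed.
Lemma subspace_sum V n (c : 'I_n -> R[i]) (b : 'I_n -> T -> R[i]) :
  subspace V -> (forall i, V (b i)) -> V (fun x => \sum_i c i * b i x).
Proof.
move=> sV; elim: n c b => [|n IH] c b Vb.
  by rewrite (_ : (fun x => _) = fun=> 0); [exact: sV.1|apply/funext => x; rewrite big_ord0].
rewrite (_ : (fun x => _) = fun x =>
   c ord0 * b ord0 x + \sum_(i < n) c (lift ord0 i) * b (lift ord0 i) x); last first.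
  by apply/funext => x; rewrite big_ord_recl.
by apply: sV.2 => //; exact: IH.
Qed.

End Subspaces.

(** * The inner product of square integrable functions *)

Section L2Space.
Context d (T : measurableType d) (R : realType) (mu : {measure set T -> \bar R}).
Implicit Types (f g h : T -> R[i]) (A V : set (T -> R[i])).

Definition sqnorm f : R := Rintegral mu setT (fun x => normsq (f x)).

Lemma L2norm_lt f (e : R) : 0 < e -> (L2norm mu f < e) = (sqnorm f < e ^+ 2).
Proof.
move=> e0; rewrite /L2norm -/(sqnorm f).
by rewrite -{1}(ger0_norm (ltW e0)) -sqrtr_sqr ltr_sqrt// exprn_gt0.
Qed.

Lemma measurable_normsq f : measurable_fun setT (fun x => complex.Re (f x)) ->
  measurable_fun setT (fun x => complex.Im (f x)) ->
  measurable_fun setT (fun x => normsq (f x)).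
Proof. by move=> mr mi; apply: measurable_funD; apply: measurable_funX. Qed.

Lemma L2_integrable f : L2 mu f -> mu.-integrable setT (EFin \o (fun x => normsq (f x))).
Proof.
case=> mr mi fi; apply/integrableP; split.
  by apply/measurable_EFinP; exact: measurable_normsq.
rewrite (eq_integral (fun x => (normsq (f x))%:E)) // => x _ /=.
by rewrite ger0_norm ?normsq_ge0.
Qed.

Lemma L2_intro f : measurable_fun setT (fun x => complex.Re (f x)) ->
  measurable_fun setT (fun x => complex.Im (f x)) ->
  mu.-integrable setT (EFin \o (fun x => normsq (f x))) -> L2 mu f.
Proof.
move=> mr mi /integrableP[_ fi]; split => //.
rewrite (eq_integral (fun x => `|(EFin \o (fun x => normsq (f x))) x|%E)) // => x _ /=.
by rewrite ger0_norm ?normsq_ge0.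
Qed.

Lemma sqnorm_ge0 f : 0 <= sqnorm f.
Proof. by apply: Rintegral_ge0 => x _; exact: normsq_ge0. Qed.

Lemma subspaceL2 : subspace (L2 mu).
Proof.
split.
  split; [exact: measurable_cst|exact: measurable_cst|].
  rewrite (eq_integral (cst 0%E)) ?integral0// => x _.
  by rewrite normsq0.
move=> a f g Lf Lg; have If := L2_integrable Lf; have Ig := L2_integrable Lg.
case: Lf => fr fi _; case: Lg => gr gi _.
have mr : measurable_fun setT (fun x => complex.Re (a * f x + g x)).
  rewrite (_ : (fun x => _) = (fun x => complex.Re a * complex.Re (f x)
     - complex.Im a * complex.Im (f x) + complex.Re (g x))); last first.
    by apply/funext => x; rewrite !partsE.
  by apply: measurable_funD => //; apply: measurable_funB; apply: measurable_funM.
have mi : measurable_fun setT (fun x => complex.Im (a * f x + g x)).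
  rewrite (_ : (fun x => _) = (fun x => complex.Re a * complex.Im (f x)
     + complex.Im a * complex.Re (f x) + complex.Im (g x))); last first.
    by apply/funext => x; rewrite !partsE.
  by apply: measurable_funD => //; apply: measurable_funD; apply: measurable_funM.
apply: L2_intro => //.
have J : mu.-integrable setT (fun x => (2 * normsq a)%:E * (normsq (f x))%:E
    + 2%:E * (normsq (g x))%:E)%E.
  by apply: integrableD => //; apply: integrableZl.
apply: le_integrable J => //.
  by apply/measurable_EFinP; exact: measurable_normsq.
move=> x _ /=; rewrite lee_fin !ger0_norm ?normsq_ge0//; last first.
  by rewrite addr_ge0 ?mulr_ge0 ?normsq_ge0.
by rewrite -mulrA -normsqM; exact: normsqD.
Qed.

Lemma L2_mulJ_Re f g : L2 mu f -> L2 mu g ->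
  mu.-integrable setT (EFin \o (fun x => complex.Re (f x * conjc (g x)))).
Proof.
move=> Lf Lg; have If := L2_integrable Lf; have Ig := L2_integrable Lg.
case: Lf => fr fi _; case: Lg => gr gi _.
apply: le_integrable (integrableD measurableT If Ig) => //.
  apply/measurable_EFinP; rewrite (_ : (fun x => _) = fun x =>
     complex.Re (f x) * complex.Re (g x) + complex.Im (f x) * complex.Im (g x)).
    by apply: measurable_funD; apply: measurable_funM.
  by apply/funext => x; rewrite !partsE; ring.
move=> x _ /=; rewrite lee_fin [leRHS]ger0_norm; last first.
  exact: addr_ge0 (normsq_ge0 _) (normsq_ge0 _).
exact: Re_mulJ.
Qed.

Lemma L2_mulJ_Im f g : L2 mu f -> L2 mu g ->
  mu.-integrable setT (EFin \o (fun x => complex.Im (f x * conjc (g x)))).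
Proof.
move=> Lf Lg; have If := L2_integrable Lf; have Ig := L2_integrable Lg.
case: Lf => fr fi _; case: Lg => gr gi _.
apply: le_integrable (integrableD measurableT If Ig) => //.
  apply/measurable_EFinP; rewrite (_ : (fun x => _) = fun x =>
     complex.Im (f x) * complex.Re (g x) - complex.Re (f x) * complex.Im (g x)).
    by apply: measurable_funB; apply: measurable_funM.
  by apply/funext => x; rewrite !partsE; ring.
move=> x _ /=; rewrite lee_fin [leRHS]ger0_norm; last first.
  exact: addr_ge0 (normsq_ge0 _) (normsq_ge0 _).
exact: Im_mulJ.
Qed.

Lemma innerJ f g : L2 mu f -> L2 mu g -> inner mu g f = conjc (inner mu f g).
Proof.
move=> Lf Lg; apply: complexP; rewrite !partsE /=.
  by apply: eq_Rintegral => x _; rewrite !partsE; ring.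
rewrite -mulN1r -RintegralZl//; last exact: L2_mulJ_Im.
by apply: eq_Rintegral => x _; rewrite !partsE; ring.
Qed.

Lemma innerDl a f g h : L2 mu f -> L2 mu g -> L2 mu h ->
  inner mu (fun x => a * f x + g x) h = a * inner mu f h + inner mu g h.
Proof.
move=> Lf Lg Lh.
have ifr := L2_mulJ_Re Lf Lh; have ifi := L2_mulJ_Im Lf Lh.
have igr := L2_mulJ_Re Lg Lh; have igi := L2_mulJ_Im Lg Lh.
have iZ c F : mu.-integrable setT (EFin \o F) ->
    mu.-integrable setT (EFin \o (fun x => c * F x)).
  by move=> iF; apply: (integrableZl measurableT c iF).
have iD (F H : T -> R) : mu.-integrable setT (EFin \o F) -> mu.-integrable setT (EFin \o H) ->
    mu.-integrable setT (EFin \o (fun x => F x + H x)).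
  by move=> iF iH; apply: (integrableD measurableT iF iH).
apply: complexP; rewrite !partsE /=.
  rewrite -!RintegralZl// -RintegralB ?iZ// -RintegralD ?iZ//; last first.
    rewrite (_ : _ \o _ = EFin \o (fun x => complex.Re a * complex.Re (f x * (h x)^*%C)
       + (- complex.Im a) * complex.Im (f x * (h x)^*%C))); first by apply: iD; exact: iZ.
    by apply/funext => x /=; rewrite mulNr.
  by apply: eq_Rintegral => x _; rewrite !partsE; ring.
rewrite -!RintegralZl// -RintegralD ?iZ// -RintegralD ?iD ?iZ//.
by apply: eq_Rintegral => x _; rewrite !partsE; ring.
Qed.

Lemma innerff f : inner mu f f = Complex (sqnorm f) 0.
Proof.
apply: complexP => /=.
  by apply: eq_Rintegral => x _; rewrite /normsq !partsE; ring.
rewrite (@eq_Rintegral _ _ _ _ _ (cst 0)) ?Rintegral_cst ?mul0r// => x _.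
by rewrite /= !partsE; ring.
Qed.

Lemma ae0_sqnorm f : L2 mu f -> ae0 mu f <-> sqnorm f = 0.
Proof.
move=> Lf; have If := L2_integrable Lf.
have := @ae_eq_integral_abs _ _ _ mu setT measurableT _ (measurable_int mu If).
rewrite (eq_integral (fun x => (normsq (f x))%:E)); last first.
  by move=> x _ /=; rewrite ger0_norm ?normsq_ge0.
move=> h; split.
  move=> f0; rewrite /sqnorm /Rintegral h.2//.
  by apply: filterS f0 => x fx _ /=; rewrite fx normsq0.
move=> f0; have : (\int[mu]_x (normsq (f x))%:E = 0)%E.
  rewrite -[LHS]fineK; first by rewrite [fine _]f0.
  have /= := integrable_fin_num measurableT If; apply.
move=> /h; apply: filterS => x /(_ I) /= [] ?; exact: normsq_eq0.
Qed.

Lemma inner_ae0 f g : L2 mu f -> L2 mu g -> ae0 mu f -> inner mu f g = 0.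
Proof.
move=> Lf Lg f0; apply: complexP => /=.
  rewrite /Rintegral (ae_eq_integral (cst 0%E)) ?integral0//.
    exact: measurable_int (L2_mulJ_Re Lf Lg).
  by apply: filterS f0 => x fx _ /=; rewrite fx mul0r.
rewrite /Rintegral (ae_eq_integral (cst 0%E)) ?integral0//.
  exact: measurable_int (L2_mulJ_Im Lf Lg).
by apply: filterS f0 => x fx _ /=; rewrite fx mul0r.
Qed.

Lemma inner0l h : L2 mu h -> inner mu (fun=> 0) h = 0.
Proof.
move=> Lh; apply: inner_ae0 => //; first exact: subspaceL2.1.
exact: aeW.
Qed.

Lemma inner_suml n (c : 'I_n -> R[i]) (b : 'I_n -> T -> R[i]) h :
  (forall i, L2 mu (b i)) -> L2 mu h ->
  inner mu (fun x => \sum_i c i * b i x) h = \sum_i c i * inner mu (b i) h.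
Proof.
move=> Lb Lh; elim: n c b Lb => [|n IH] c b Lb.
  rewrite big_ord0 -[RHS](inner0l Lh); congr (inner mu); apply/funext => x.
  by rewrite big_ord0.
rewrite big_ord_recl -IH// -innerDl//; last exact: subspace_sum subspaceL2 _.
by congr (inner mu); apply/funext => x; rewrite big_ord_recl.
Qed.

Lemma orthC f g : L2 mu f -> L2 mu g -> inner mu f g = 0 -> inner mu g f = 0.
Proof. by move=> Lf Lg fg; rewrite innerJ// fg; apply: complexP; rewrite /= ?oppr0. Qed.

Lemma subspace_orth A : A `<=` L2 mu -> subspace (orth mu A).
Proof.
move=> AL; split.
  by split; [exact: subspaceL2.1|move=> g /AL; exact: inner0l].
move=> a f g [Lf fA] [Lg gA]; split; first exact: subspaceL2.2.
by move=> h Ah; rewrite innerDl ?fA ?gA ?mulr0 ?addr0//; exact: AL.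
Qed.

Lemma ae0_subspace : subspace (ae0 mu).
Proof.
split; first exact: aeW.
move=> a f g f0 g0; apply: filterS2 f0 g0 => x -> ->.
by rewrite mulr0 addr0.
Qed.

End L2Space.

(** * Projection onto subspaces of finite dimension *)

Section Projection.
Context d (T : measurableType d) (R : realType) (mu : {measure set T -> \bar R}).
Implicit Types (f g h : T -> R[i]) (A F V : set (T -> R[i])).

Lemma inner0r h : L2 mu h -> inner mu h (fun=> 0) = 0.
Proof. by move=> Lh; apply: orthC; rewrite ?inner0l//; exact: (subspaceL2 mu).1. Qed.

Lemma orth_combr n (c : 'I_n -> R[i]) (b : 'I_n -> T -> R[i]) h :
  (forall i, L2 mu (b i)) -> L2 mu h -> (forall i, inner mu h (b i) = 0) ->
  inner mu h (fun x => \sum_i c i * b i x) = 0.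
Proof.
move=> Lb Lh hb; apply: orthC => //; first exact: subspace_sum (subspaceL2 mu) Lb.
rewrite inner_suml// big1// => i _.
by rewrite (orthC _ _ (hb i)) ?mulr0.
Qed.

Lemma orth_addr f g h : L2 mu f -> L2 mu g -> L2 mu h ->
  inner mu h f = 0 -> inner mu h g = 0 -> inner mu h (fun x => f x + g x) = 0.
Proof.
move=> Lf Lg Lh hf hg.
have LD := subspaceD (subspaceL2 mu) Lf Lg.
apply: orthC => //; rewrite -[RHS](addr0 0) -{1}(orthC Lh Lf hf) -(orthC Lh Lg hg).
rewrite -[inner mu f h]mul1r -innerDl//.
by congr (inner mu); apply/funext => x; rewrite mul1r.
Qed.

Lemma orth_ae0 f h : L2 mu f -> L2 mu h -> ae0 mu f -> inner mu h f = 0.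
Proof. by move=> Lf Lh f0; apply: orthC => //; exact: inner_ae0. Qed.

Lemma self_orth f : L2 mu f -> inner mu f f = 0 -> ae0 mu f.
Proof. by move=> Lf; rewrite innerff => -[f0]; apply/ae0_sqnorm. Qed.

(** The family b may be dependent modulo null functions: when the part r0 of
    the new vector that is orthogonal to the others is null, dividing by its zero
    norm yields the coefficient 0, which is then correct. *)
Lemma gram_schmidt n (b : 'I_n -> T -> R[i]) : (forall i, L2 mu (b i)) ->
  forall f, L2 mu f -> exists c : 'I_n -> R[i],
    forall i, inner mu (fun x => f x - \sum_j c j * b j x) (b i) = 0.
Proof.
elim: n b => [|n IH] b Lb f Lf; first by exists (fun=> 0) => -[].
pose bl i := b (lift ord0 i).
have Lbl i : L2 mu (bl i) by exact: Lb.
have sL := subspaceL2 mu.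
have [c0 c0P] := IH bl Lbl _ (Lb ord0).
have [cf cfP] := IH bl Lbl f Lf.
pose r0 x := b ord0 x - \sum_j c0 j * bl j x.
pose rf x := f x - \sum_j cf j * bl j x.
have Lr0 : L2 mu r0 by apply: subspaceB => //; exact: subspace_sum.
have Lrf : L2 mu rf by apply: subspaceB => //; exact: subspace_sum.
pose t := inner mu rf r0 / inner mu r0 r0.
pose res x := (- t) * r0 x + rf x.
have Lres : L2 mu res by exact: sL.2.
have resr0 : inner mu res r0 = 0.
  rewrite innerDl//; have [r00|r00] := eqVneq (inner mu r0 r0) 0.
    by rewrite r00 mulr0 add0r orth_ae0//; exact: self_orth.
  by rewrite mulNr divfK// addNr.
have resbl i : inner mu res (bl i) = 0 by rewrite innerDl// c0P cfP mulr0 addr0.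
exists (fun i => if unlift ord0 i is Some j then cf j - t * c0 j else t).
suff E : (fun x => f x - \sum_j (if unlift ord0 j is Some j'
    then cf j' - t * c0 j' else t) * b j x) = res.
  rewrite E => i; have [j ->|->] := unliftP ord0 i; first exact: resbl.
  rewrite (_ : b ord0 = fun x => r0 x + \sum_j c0 j * bl j x); last first.
    by apply/funext => x; rewrite subrK.
  by apply: orth_addr => //; [exact: subspace_sum|exact: orth_combr].
apply/funext => x; rewrite big_ord_recl unlift_none.
under eq_bigr do rewrite liftK mulrBl -mulrA.
rewrite big_split /= sumrN -mulr_sumr /res /r0 /rf /bl.
ring.
Qed.

(** Finite dimension modulo null functions, by generators that may be
    dependent, which is all that Gram-Schmidt asks for. *)
Definition fingen V := exists n (b : 'I_n -> T -> R[i]),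
  (forall i, V (b i)) /\
  forall f, V f -> exists c : 'I_n -> R[i], ae0 mu (fun x => f x - \sum_i c i * b i x).

(** The residual left by Gram-Schmidt is orthogonal to the generators, hence
    to V, because null functions are orthogonal to everything. *)
Lemma projection V : subspace V -> V `<=` L2 mu -> fingen V ->
  forall f, L2 mu f -> exists2 p, V p & orth mu V (fun x => f x - p x).
Proof.
move=> sV VL [n [b [Vb gV]]] f Lf.
have sL := subspaceL2 mu.
have Lb i : L2 mu (b i) by exact: VL.
have [c cP] := gram_schmidt Lb Lf.
exists (fun x => \sum_i c i * b i x); first exact: subspace_sum.
have Lr : L2 mu (fun x => f x - \sum_i c i * b i x).
  by apply: subspaceB => //; exact: subspace_sum.
split => // g Vg; have [e eP] := gV g Vg.
have LS : L2 mu (fun x => \sum_i e i * b i x) by exact: subspace_sum.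
rewrite (_ : g = fun x => \sum_i e i * b i x + (g x - \sum_i e i * b i x)); last first.
  by apply/funext => x; rewrite addrC subrK.
have Lg := VL _ Vg.
apply: orth_addr => //; first exact: subspaceB.
  exact: orth_combr.
by apply: orth_ae0 => //; exact: subspaceB.
Qed.

Definition ae_closed V := forall f g, V f -> L2 mu g ->
  ae0 mu (fun x => g x - f x) -> V g.

Lemma sqnorm_pythagoras f g : L2 mu f -> L2 mu g -> inner mu f g = 0 ->
  sqnorm mu (fun x => f x + g x) = sqnorm mu f + sqnorm mu g.
Proof.
move=> Lf Lg fg; have sL := subspaceL2 mu.
have LD := subspaceD sL Lf Lg.
suff : inner mu (fun x => f x + g x) (fun x => f x + g x) = inner mu f f + inner mu g g.
  by rewrite !innerff => -[].
rewrite -[inner mu f f]mul1r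
  (_ : (fun x => f x + g x) = (fun x => 1 * f x + g x)) in LD *; last first.
  by apply/funext => x; rewrite mul1r.
rewrite innerDl// (innerJ LD Lf) (innerJ LD Lg) !innerDl// !fg (orthC Lf Lg fg).
rewrite !innerff; apply: complexP; rewrite !partsE /=; ring.
Qed.

(** By Pythagoras the residual of the projection of f is no longer than f - g,
    for any g in V; it is null if V comes arbitrarily close to f. *)
Lemma fingen_closed V : subspace V -> V `<=` L2 mu -> fingen V -> ae_closed V ->
  L2closure mu V = V.
Proof.
move=> sV VL gV aV; apply/seteqP; split; last first.
  move=> f Vf; split; first exact: VL.
  move=> e e0; exists f; split => //; first exact: VL.
  rewrite L2norm_lt// (_ : sqnorm _ _ = 0) ?exprn_gt0//.
  apply/ae0_sqnorm; first by apply: subspaceB (subspaceL2 mu) _ _; exact: VL.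
  by apply: aeW => x; rewrite subrr.
move=> f [Lf cf]; have [p Vp [Lr rV]] := projection sV VL gV Lf.
apply: (aV p) => //; apply/ae0_sqnorm => //.
apply/eqP; rewrite eq_le sqnorm_ge0 andbT leNgt; apply/negP => pos.
have e0 : 0 < Num.sqrt (sqnorm mu (fun x => f x - p x)) by rewrite sqrtr_gt0.
have [g [Vg Lg]] := cf _ e0.
rewrite L2norm_lt// sqr_sqrtr ?sqnorm_ge0// ltNge => /negP; apply.
have Vpg := subspaceB sV Vp Vg.
rewrite (_ : (fun x => f x - g x) = fun x => (f x - p x) + (p x - g x)); last first.
  by apply/funext => x; rewrite addrA subrK.
rewrite (sqnorm_pythagoras Lr) ?lerDl ?sqnorm_ge0//; [exact: VL|exact: rV].
Qed.

(** The residuals b i of the projections of the h i onto F generate the part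
    of V orthogonal to F: what a combination of them misses lies in F, up to a null
    function, and is orthogonal to F. *)
Lemma complement_basis V F n (h : 'I_n -> T -> R[i]) :
  subspace V -> V `<=` L2 mu -> subspace F -> F `<=` V -> fingen F ->
  (forall i, V (h i)) ->
  (forall f, V f -> exists c : 'I_n -> R[i], exists2 g, F g &
     ae0 mu (fun x => f x - \sum_i c i * h i x - g x)) ->
  exists b : 'I_n -> T -> R[i],
   [/\ forall i, (V `&` orth mu F) (b i), forall i, F (fun x => h i x - b i x) &
      forall f, (V `&` orth mu F) f -> exists c : 'I_n -> R[i],
         ae0 mu (fun x => f x - \sum_i c i * b i x)].
Proof.
move=> sV VL sF FV gF Vh gV; have sL := subspaceL2 mu.
have FL : F `<=` L2 mu by move=> f /FV/VL.
have /choice[p pP] : forall i, exists p, F p /\ orth mu F (fun x => h i x - p x).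
  by move=> i; have [p Fp ?] := projection sF FL gF (VL _ (Vh i)); exists p.
pose b i x := h i x - p i x.
have Vb i : (V `&` orth mu F) (b i).
  by split; [apply: subspaceB => //; apply: FV|]; have [] := pP i.
exists b; split => //.
  move=> i; rewrite (_ : (fun x => _) = p i); first by have [] := pP i.
  by apply/funext => x; rewrite /b opprB addrC subrK.
move=> f [Vf [Lf fF]]; have [c [g Fg fg]] := gV f Vf.
exists c; set u := (fun x => _).
have [Lu uF] : orth mu F u.
  apply: subspaceB; first exact: subspace_orth.
    by [].
  by apply: subspace_sum; [exact: subspace_orth|move=> i; have [] := Vb i].
apply: self_orth => //.
pose v x := g x + \sum_i c i * p i x.
have Fv : F v.
  apply: subspaceD => //; apply: subspace_sum => // i; by have [] := pP i.
rewrite [X in inner mu _ X](_ : u = fun x => v x + (u x - v x)); last first.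
  by apply/funext => x; rewrite addrC subrK.
have Lv := FL _ Fv; apply: orth_addr => //; first exact: subspaceB.
  exact: uF.
apply: orth_ae0 => //; first exact: subspaceB.
rewrite (_ : (fun x => _) = fun x => f x - \sum_i c i * h i x - g x) //.
apply/funext => x; rewrite /u /v /b.
under eq_bigr do rewrite mulrBr.
by rewrite big_split /= sumrN; ring.
Qed.

End Projection.

(** * Orthogonalization of a filtration *)

Section Filtration.
Context d (T : measurableType d) (R : realType) (mu : {measure set T -> \bar R}).
Implicit Types (f g h : T -> R[i]).
Variable F : nat -> set (T -> R[i]).
Hypotheses (sF : forall k, subspace (F k)) (FL : forall k, F k `<=` L2 mu)
  (gF : forall k, fingen mu (F k)) (aF : forall k, ae_closed mu (F k))
  (FS : forall k, F k `<=` F k.+1) (F0 : F 0%N `<=` ae0 mu).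

Let K m := F m.+1 `&` orth mu (F m).

Lemma filtration_le m p : (m <= p)%N -> F m `<=` F p.
Proof.
move=> /subnK <-; elim: (p - m)%N => [|k IH] f Ff //.
by rewrite addSn; apply: FS; exact: IH.
Qed.

Lemma subspace_increment m : subspace (K m).
Proof.
have [z0 oD] := subspace_orth (@FL m); have [s0 sD] := sF m.+1.
by split=> [//|a f g [? ?] [? ?]]; split; [exact: sD|exact: oD].
Qed.

Lemma fingen_increment m : fingen mu (K m).
Proof.
have [n [h [Fh hP]]] := gF m.+1.
have [|b [Kb _ bP]] := @complement_basis _ _ _ mu (F m.+1) (F m) n h
   (sF _) (@FL _) (sF _) (@FS _) (gF _) Fh.
  move=> f /hP[c cP]; exists c, (fun=> 0); first exact: (sF _).1.
  by apply: filterS cP => x; rewrite subr0.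
by exists n, b.
Qed.

Lemma ae_closed_increment m : ae_closed mu (K m).
Proof.
move=> f g [Ff [Lf fF]] Lg fg; split; first exact: aF Ff Lg fg.
split => // h Fh; have Lh := FL Fh.
rewrite (_ : g = fun x => 1 * f x + (g x - f x)); last first.
  by apply/funext => x; rewrite mul1r addrC subrK.
have LB := subspaceB (subspaceL2 mu) Lg Lf.
by rewrite innerDl// fF// inner_ae0// mulr0 addr0.
Qed.

(** An element of a step of the filtration is its projection onto the
    previous step plus an element of the increment. *)
Lemma psum_increment m : F m.+1 `<=` psum K m.+1.
Proof.
have sL := subspaceL2 mu.
elim: m => [|m IH] f Ff.
  exists (fun=> f); split; last by apply/funext => x; rewrite big_ord1.
  case=> // _; split => //; split; first exact: FL Ff.
  by move=> g /[dup] /FL Lg /F0; apply: orth_ae0 => //; exact: FL Ff.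
have [p Fp fp] := projection (sF m.+1) (@FL _) (gF m.+1) (FL Ff).
have [g [Kg gE]] := IH p Fp.
exists (fun j => if j == m.+1 then fun x => f x - p x else g j); split.
  move=> j; rewrite ltnS leq_eqVlt; case: eqP => [-> _|_ /= jm]; last exact: Kg.
  by split => //; apply: subspaceB => //; exact: FS.
apply/funext => x; rewrite big_ord_recr /= eqxx.
under eq_bigr => j _ do rewrite (ltn_eqF (ltn_ord j)).
by rewrite -[\sum_(j < m.+1) _]/((fun x => \sum_(j < m.+1) g j x) x) -gE addrC subrK.
Qed.

Lemma increment_psum k : psum K k `<=` F k.+1.
Proof.
move=> f [g [Kg ->]].
suff : F k (fun x => \sum_(j < k) g j x) by exact: FS.
elim: k Kg => [|k IH] Kg.
  rewrite (_ : (fun x => _) = fun=> 0); first exact: (sF _).1.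
  by apply/funext => x; rewrite big_ord0.
rewrite (_ : (fun x => _) = fun x => \sum_(j < k) g j x + g k x); last first.
  by apply/funext => x; rewrite big_ord_recr.
apply: subspaceD => //; last by have [] := Kg k (ltnSn k).
by apply: FS; apply: IH => j jk; apply: Kg; exact: ltnW.
Qed.

(** Each step is the previous one plus an increment orthogonal to it, so the
    increments span the union of the steps. The harmonic and the polynomial
    decompositions are both instances. *)
Lemma hilbert_sum_filtration :
  hilbert_sum mu (L2closure mu (\bigcup_k F k.+1)) K.
Proof.
split.
- move=> m; split; first exact: subspace_increment.
  apply: fingen_closed; [exact: subspace_increment| |exact: fingen_increment|
    exact: ae_closed_increment].
  by move=> f [/FL].
- have Hlt m p f g : (m < p)%N -> K m f -> K p g -> inner mu g f = 0.
    by move=> mp [/(filtration_le mp) Ff _] [_ [_]]; exact.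
  move=> m p f g; case: (ltngtP m p) => // mp _ Kf Kg.
    apply: orthC; [exact: FL Kg.1|exact: FL Kf.1|exact: Hlt mp Kf Kg].
  exact: Hlt mp Kg Kf.
- congr (L2closure mu _); apply/seteqP; split => f [k _ Ff].
    by exists k.+1 => //; exact: psum_increment.
  by exists k => //; exact: increment_psum.
Qed.

(** A dependence among the residuals of the h i is a dependence among the
    h i modulo F m. *)
Lemma has_dim_increment m n (h : 'I_n -> T -> R[i]) :
  (forall i, F m.+1 (h i)) ->
  (forall f, F m.+1 f -> exists c : 'I_n -> R[i], exists2 g, F m g &
     ae0 mu (fun x => f x - \sum_i c i * h i x - g x)) ->
  (forall (c : 'I_n -> R[i]) g, F m g ->
     ae0 mu (fun x => \sum_i c i * h i x - g x) -> forall i, c i = 0) ->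
  has_dim (ae0 mu) (K m) n.
Proof.
move=> Fh hP hI.
have [b [Kb bh bP]] := @complement_basis _ _ _ mu (F m.+1) (F m) n h
   (sF _) (@FL _) (sF _) (@FS _) (gF _) Fh hP.
exists b; split => // c c0; apply: (hI c _ (subspace_sum c (sF m) bh)).
apply: filterS c0 => x cx.
rewrite -sumrB -[RHS]cx; apply: eq_bigr => i _; ring.
Qed.
End Filtration.

(** * Function spaces inside the span of finitely many functions *)

Section FiniteSpan.
Context {R : realType} {T : Type}.
Implicit Types (V W : set (T -> R[i])).

Definition finspan V := exists n (e : 'I_n -> T -> R[i]),
  forall f, V f -> exists c : 'I_n -> R[i], f = fun x => \sum_i c i * e i x.

(** By induction on the number of spanning functions: either V lies in the
    span of all of them but the first, or an element f0 of V with a nonzero first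
    coordinate completes a basis of the intersection of V with that span. *)
Lemma has_dim_finspan V : subspace V -> finspan V ->
  exists k, has_dim [set fun=> 0] V k.
Proof.
move=> sV [n [e]]; elim: n e V sV => [|n IH] e V sV eV.
  exists 0%N; exists (fun=> fun=> 0); split => [[]//|c _ []//|f /eV[c ->]].
  by exists (fun=> 0); apply/funext => x; rewrite !big_ord0 subrr.
pose W := V `&` [set f | exists c : 'I_n -> R[i], f = fun x => \sum_i c i * e (lift ord0 i) x].
have sW : subspace W.
  split.
    split; first exact: sV.1.
    by exists (fun=> 0); apply/funext => x; rewrite big1// => i _; rewrite mul0r.
  move=> a f g [Vf [c fc]] [Vg [c' gc]]; split; first exact: sV.2.
  exists (fun i => a * c i + c' i); apply/funext => x.
  by rewrite fc gc mulr_sumr -big_split/=; apply: eq_bigr => i _; ring.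
have [k [b [Wb bI bP]]] : exists k, has_dim [set fun=> 0] W k.
  by apply: (IH (fun i => e (lift ord0 i))) => // f [].
have [VW|/existsNP[f0 /not_implyP[Vf0 Wf0]]] := pselect (forall f, V f -> W f).
  exists k, b; split => // [i|f /VW]; [by have [] := Wb i|exact: bP].
have [d dE] := eV _ Vf0.
have d0 : d ord0 != 0.
  apply: contra_notN Wf0 => /eqP d0; split => //.
  exists (fun i => d (lift ord0 i)); rewrite dE; apply/funext => x.
  by rewrite big_ord_recl d0 mul0r add0r.
pose b' (i : 'I_k.+1) := if unlift ord0 i is Some j then b j else f0.
have b'E (c : 'I_k.+1 -> R[i]) x : \sum_i c i * b' i x =
    c ord0 * f0 x + \sum_i c (lift ord0 i) * b i x.
  rewrite big_ord_recl /b' unlift_none; congr (_ + _).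
  by apply: eq_bigr => i _; rewrite liftK.
exists k.+1, b'; split.
- by move=> i; rewrite /b'; case: unlift => // j; have [] := Wb j.
- move=> c cE.
  have {}cE x : c ord0 * f0 x + \sum_i c (lift ord0 i) * b i x = 0.
    by rewrite -b'E; apply: (congr1 (@^~ x) cE).
  have c00 : c ord0 = 0.
    apply/eqP; apply: contra_notT Wf0 => c0.
    have -> : f0 = fun x => - (c ord0)^-1 * (\sum_i c (lift ord0 i) * b i x) + 0.
      apply/funext => x; apply: (mulfI c0).
      rewrite addr0 mulrA mulrN divff// mulN1r.
      by apply/eqP; rewrite -addr_eq0 cE.
    apply: sW.2; last exact: sW.1.
    exact: subspace_sum.
  move=> i; have [j ->|->//] := unliftP ord0 i.
  apply: (bI (fun i => c (lift ord0 i))); apply/funext => x.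
  by rewrite -[RHS](cE x) c00 mul0r add0r.
- move=> f Vf; have [g gE] := eV f Vf.
  pose t := g ord0 / d ord0.
  have Wg : W (fun x => f x - t * f0 x).
    split; first by apply: subspaceB => //; exact: subspaceZ.
    exists (fun i => g (lift ord0 i) - t * d (lift ord0 i)).
    apply/funext => x; rewrite gE dE !big_ord_recl mulrDr mulrA divfK//.
    rewrite opprD addrACA subrr add0r mulr_sumr -sumrB.
    by apply: eq_bigr => i _; rewrite mulrBl mulrA.
  have [c cE] := bP _ Wg.
  exists (fun i => if unlift ord0 i is Some j then c j else t).
  apply/funext => x; rewrite b'E unlift_none.
  under eq_bigr do rewrite liftK.
  by rewrite opprD addrA; exact: (congr1 (@^~ x) cE).
Qed.

Lemma subspace_psum A k : (forall j, subspace (A j)) -> subspace (@psum R T A k).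
Proof.
move=> sA; split.
  exists (fun=> fun=> 0); split; first by move=> j _; exact: (sA j).1.
  by apply/funext => x; rewrite big1.
move=> a f g [u [Au ->]] [v [Av ->]]; exists (fun j x => a * u j x + v j x).
split; first by move=> j jk; apply: (sA j).2; [exact: Au|exact: Av].
by apply/funext => x; rewrite mulr_sumr -big_split.
Qed.

Lemma psumS A k : (forall j, subspace (A j)) -> @psum R T A k `<=` psum A k.+1.
Proof.
move=> sA f [g [Ag ->]]; exists (fun j => if (j < k)%N then g j else fun=> 0); split.
  by move=> j _; case: ifP => [/Ag//|_]; exact: (sA j).1.
apply/funext => x; rewrite big_ord_recr /= ltnn addr0.
by apply: eq_bigr => i _; rewrite ltn_ord.
Qed.

Lemma psum_term A k : (forall j, subspace (A j)) -> A k `<=` @psum R T A k.+1.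
Proof.
move=> sA f Af; exists (fun j => if j == k then f else fun=> 0); split.
  by move=> j _; case: eqP => [->//|_]; exact: (sA j).1.
apply/funext => x; rewrite big_ord_recr /= eqxx big1 ?add0r// => i _.
by rewrite (ltn_eqF (ltn_ord i)).
Qed.

Lemma psum_le A j k : (forall j, subspace (A j)) -> (j <= k)%N ->
  @psum R T A j `<=` psum A k.
Proof.
move=> sA /subnK <-; elim: (k - j)%N => [//|i IH] f Af.
by rewrite addSn; apply: psumS => //; exact: IH.
Qed.

Lemma psum_sub A V k : subspace V -> (forall j, (j < k)%N -> A j `<=` V) ->
  @psum R T A k `<=` V.
Proof.
move=> sV AV f [g [Ag ->]].
rewrite (_ : (fun x => _) = fun x => \sum_(j < k) 1 * g j x).
  by apply: subspace_sum => // i; apply: AV => //; exact: Ag.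
by apply/funext => x; apply: eq_bigr => i _; rewrite mul1r.
Qed.
End FiniteSpan.

(** * Homogeneous polynomials *)

(** Homogeneous components are separated by this lemma: it compares the
    coefficients of identities between polynomials in the dilation parameter. *)
Lemma poly_eq0_near (R : realType) (P : {poly R[i]}) (e : R) : 0 < e ->
  (forall r : R, 0 < r < e -> P.[Complex r 0] = 0) -> P = 0.
Proof.
move=> e0 P0; apply/eqP; apply: contraT => Pn0.
pose rs := [seq Complex (e / (i.+2)%:R) (0 : R) | i <- iota 0 (size P)].
have := @max_poly_roots _ P rs Pn0; rewrite size_map size_iota ltnn => -> //.
  apply/allP => z /mapP[i _ ->]; rewrite /root P0// divr_gt0//=.
  by rewrite ltr_pdivrMr// ltr_pMr// ltr1n.
rewrite map_inj_uniq ?iota_uniq// => i j [] /(mulfI (lt0r_neq0 e0)) /invr_inj /eqP.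
by rewrite eqr_nat => /eqP [].
Qed.

Lemma complexrX (R : realType) (r : R) k : Complex (r ^+ k) 0 = Complex r 0 ^+ k :> R[i].
Proof. exact: (rmorphXn (real_complex R)). Qed.

Lemma complexrM (R : realType) (r s : R) :
  Complex (r * s) 0 = Complex r 0 * Complex s 0 :> R[i].
Proof. exact: (rmorphM (real_complex R)). Qed.

Section Polynomials.
Context {R : realType} (G : carnotGroup R).
Local Notation n := (cg_dim G).
Implicit Types (m : mpoly.multinom n) (q : mpoly.mpoly n R[i]).

Definition complex_coords (x : pt G) : 'I_n -> R[i] := fun i => Complex (x 0 i) 0.
Definition wdegree m : nat := (\sum_i cg_wt G i * m i)%N.
Definition monom m (x : pt G) : R[i] := \prod_i complex_coords x i ^+ m i.

(** This is why a space of homogeneous polynomials has finite dimension: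
    the weighted degree bounds the degree. *)
Lemma mdeg_le_wdegree m : (mpoly.mdeg m <= wdegree m)%N.
Proof.
rewrite mpoly.mdegE /wdegree leq_sum// => i _.
by have /andP[w _] := cg_wt_range i; rewrite leq_pmull.
Qed.

Lemma monom_dil r m x : monom m (dil r x) = Complex (r ^+ wdegree m) 0 * monom m x.
Proof.
rewrite complexrX /wdegree -prodrXr -big_split; apply: eq_bigr => i _ /=.
by rewrite /complex_coords mxE complexrM complexrX exprMn -exprM.
Qed.

Lemma mevalE q x : mpoly.meval (complex_coords x) q =
  \sum_(m <- mpoly.msupp q) mpoly.mcoeff m q * monom m x.
Proof. exact: mpoly.mevalE. Qed.

Lemma monomE m : monom m = fun x => mpoly.meval (complex_coords x) (mpoly.mpolyX R[i] m).
Proof. by apply/funext => x; rewrite mpoly.mevalX. Qed.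

Lemma Pm_monom m : Pm (wdegree m) (monom m).
Proof.
split; first by exists (mpoly.mpolyX R[i] m); exact: monomE.
by move=> r x _; exact: monom_dil.
Qed.

Definition size_le_poly k : set (pt G -> R[i]) :=
  [set p | exists2 q, (mpoly.mmeasure mpoly.mdeg q <= k)%N &
    p = fun x => mpoly.meval (complex_coords x) q].

Lemma subspace_size_le k : subspace (size_le_poly k).
Proof.
split.
  by exists 0 => //; [rewrite mpoly.mmeasure0|apply/funext => x; rewrite mpoly.meval0].
move=> a f g [p pk ->] [q qk ->]; exists (a *: p + q).
  rewrite (leq_trans (mpoly.mmeasureD_le _ _ _))// geq_max qk andbT.
  exact: leq_trans (mpoly.mmeasureZ_le _ _ _) pk.
by apply/funext => x; rewrite mpoly.mevalD mpoly.mevalZ.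
Qed.

Lemma finspan_size_le k : finspan (size_le_poly k).
Proof.
pose I := mpoly.bmultinom n k.
exists #|{: I}|, (fun j => monom (enum_val j : I)).
move=> _ [q qk ->]; exists (fun j => mpoly.mcoeff (enum_val j : I) q).
apply/funext => x; rewrite {1}(mpoly.mpolywE qk).
rewrite (raddf_sum (mpoly.meval (complex_coords x))) /=.
rewrite -(big_enum_val (A := {: I}) (fun m : I => mpoly.mcoeff m q * monom m x)).
by apply: eq_big => // m _; rewrite mpoly.mevalZ mpoly.mevalX.
Qed.

(** The polynomial that defines a homogeneous function may be replaced by its
    component of weighted degree k, as p (dil r x) = r ^+ k * p x identifies two
    polynomials in r. *)
Lemma Pm_size_le k : Pm k `<=` size_le_poly k.+1.
Proof.
move=> p [[q pE] pk].
pose q' := \sum_(m <- mpoly.msupp q | wdegree m == k) mpoly.mcoeff m q *: mpoly.mpolyX R[i] m.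
exists q'.
  apply: leq_trans (mpoly.mmeasure_sum _ _ _ _) _.
  apply/bigmax_leqP_seq => m _ /eqP mk.
  apply: leq_trans (mpoly.mmeasureZ_le _ _ _) _.
  by rewrite mpoly.mmeasureX ltnS -mk mdeg_le_wdegree.
apply/funext => x.
pose P : {poly R[i]} :=
  \sum_(m <- mpoly.msupp q) (mpoly.mcoeff m q * monom m x) *: 'X^(wdegree m)
   - (p x) *: 'X^k.
have P0 : P = 0.
  apply: (@poly_eq0_near _ P 1) => // r /andP[r0 _].
  rewrite !hornerE horner_sum -complexrX [p x * _]mulrC -pk// {1}pE.
  rewrite -[mpoly.meval _ q]/(mpoly.meval (complex_coords (dil r x)) q) mevalE.
  apply/eqP; rewrite subr_eq0; apply/eqP; apply: eq_bigr => m _.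
  rewrite monom_dil hornerZ hornerXn complexrX.
  by rewrite mulrCA [RHS]mulrC.
have := congr1 (fun P : {poly R[i]} => P`_k) P0.
rewrite coef0 coefB coef_sum coefZ coefXn eqxx mulr1 => /eqP; rewrite subr_eq0 => /eqP <-.
rewrite /q' (raddf_sum (mpoly.meval (complex_coords x))) /= [RHS]big_mkcond.
apply: eq_bigr => m _; rewrite coefZ coefXn eq_sym; case: eqP => _; last by rewrite mulr0.
by rewrite mpoly.mevalZ mpoly.mevalX mulr1.
Qed.

Lemma subspace_Pm k : subspace (@Pm R G k).
Proof.
split.
  split; last by move=> *; rewrite mulr0.
  by exists 0; apply/funext => x; rewrite mpoly.meval0.
move=> a f g [[p ->] pk] [[q ->] qk]; split.
  by exists (a *: p + q); apply/funext => x; rewrite mpoly.mevalD mpoly.mevalZ.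
by move=> r x r0; rewrite pk// qk//; ring.
Qed.

Lemma psum_Pm_size_le k : psum (@Pm R G) k `<=` size_le_poly k.
Proof.
apply: psum_sub; first exact: subspace_size_le.
move=> j jk p /Pm_size_le[q qj ->]; exists q => //; exact: leq_trans qj jk.
Qed.

Lemma polynomial_psum (p : pt G -> R[i]) : polynomial_fun p -> exists k, psum (@Pm R G) k p.
Proof.
move=> [q ->].
have sP := @subspace_Pm.
have -> : (fun x : pt G => mpoly.meval (complex_coords x) q) = fun x =>
    \sum_(m <- mpoly.msupp q) mpoly.mcoeff m q * monom m x.
  by apply/funext => x; rewrite mevalE.
elim: (mpoly.msupp q) => [|m s [k IH]].
  exists 0%N; exists (fun=> fun=> 0); split => //.
  by apply/funext => x; rewrite big_nil big_ord0.
exists (maxn k (wdegree m).+1).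
rewrite (_ : (fun x => _) = fun x => mpoly.mcoeff m q * monom m x +
  (fun x => \sum_(m <- s) mpoly.mcoeff m q * monom m x) x); last first.
  by apply/funext => x; rewrite big_cons.
apply: (subspace_psum _ sP).2.
  apply: (psum_le sP (leq_maxr k _)); apply: psum_term => //; exact: Pm_monom.
exact: psum_le sP (leq_maxl _ _) _ IH.
Qed.

End Polynomials.

(** * Continuity of maps into row vectors *)

Section RowTopology.
Context {R : realType}.

Lemma cvg_row (X : Type) (F : set_system X) (FF : Filter F) n
    (f : X -> 'rV[R]_n) (l : 'rV[R]_n) :
  (forall i, (fun x => f x 0 i) @ F --> l 0 i) -> f @ F --> l.
Proof.
move=> fi; apply/cvg_ballP => e e0.
suff : \forall x \near F, forall i : 'I_n, ball (l 0 i) e (f x 0 i).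
  by apply: filterS => x xP; split => // i j; rewrite ord1; exact: xP.
apply: (@filter_forall X 'I_n (fun i => [set x | ball (l 0 i) e (f x 0 i)])).
by move=> i; exact: (cvg_ball (fi i)).
Qed.

Lemma continuous_row (X : topologicalType) n (f : X -> 'rV[R]_n) :
  (forall i, continuous (fun x => f x 0 i)) -> continuous f.
Proof. by move=> fi x; apply: cvg_row => i; exact: fi. Qed.

Lemma continuous_comp_fun (X Y Z : topologicalType) (f : X -> Y) (g : Y -> Z) :
  continuous f -> continuous g -> continuous (fun x => g (f x)).
Proof. by move=> cf cg x; exact: (continuous_comp (cf x) (cg (f x))). Qed.

Lemma continuous_scale_row n (u : 'rV[R]_n) : continuous (fun t : R => t *: u).
Proof.
apply: continuous_row => i.
rewrite (_ : (fun t => _) = fun t => t * u 0 i); last by apply/funext => t; rewrite mxE.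
exact: mulrr_continuous.
Qed.

Lemma continuous_rowmx (X : topologicalType) n m (f : X -> 'rV[R]_n) (g : X -> 'rV[R]_m) :
  continuous f -> continuous g -> continuous (fun x => row_mx (f x) (g x)).
Proof.
move=> cf cg; apply: continuous_row => i.
case: (splitP i) => j ij.
  have -> : i = lshift m j by apply: val_inj.
  have -> : (fun x => row_mx (f x) (g x) 0 (lshift m j)) = fun x => f x 0 j.
    by apply/funext => x; rewrite row_mxEl.
  move=> x; apply: (@continuous_comp _ _ _ f (fun M : 'rV_n => M 0 j)) (cf x) _.
  exact: coord_continuous.
have -> : i = rshift n j by apply: val_inj.
have -> : (fun x => row_mx (f x) (g x) 0 (rshift n j)) = fun x => g x 0 j.
  by apply/funext => x; rewrite row_mxEr.
move=> x; apply: (@continuous_comp _ _ _ g (fun M : 'rV_m => M 0 j)) (cg x) _.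
exact: coord_continuous.
Qed.

Lemma continuous_wdil (X : topologicalType) n (w : 'I_n -> nat)
    (a : X -> R) (b : X -> 'rV[R]_n) :
  continuous a -> continuous b -> continuous (fun z => wdil w (a z) (b z)).
Proof.
move=> ca cb; apply: continuous_row => i.
rewrite (_ : (fun z => _) = fun z => a z ^+ w i * b z 0 i); last first.
  by apply/funext => z; rewrite mxE.
move=> z; apply: cvgM.
  by apply: (@continuous_comp _ _ _ a (fun r : R => r ^+ w i)); [exact: ca|exact: exprn_continuous].
apply: (@continuous_comp _ _ _ b (fun M : 'rV[R]_n => M 0 i)); first exact: cb.
exact: (@coord_continuous R 1 n 0 i).
Qed.

End RowTopology.

(** * Second derivatives *)

Section SecondDerivative.
Context {R : realType}.
Implicit Types (g h : R -> R).

Definition twice_derivable g :=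
  (forall t, derivable g t 1) /\ (forall t, derivable (derive1 g : R -> R) t 1).

Definition deriv2_at0 g : R := derive1 (derive1 g) 0.

Lemma derive1_shift g (s t : R) : derive1 g (t + s) = derive1 (fun y => g (y + t)) s.
Proof.
by rewrite [t + s]addrC /derive1; under eq_fun do rewrite addrA.
Qed.

Lemma twice_derivable_cst c : twice_derivable (fun=> c).
Proof.
split=> t; first exact: derivable_cst.
rewrite (_ : derive1 _ = cst 0); first exact: derivable_cst.
by apply/funext => s; rewrite derive1_cst.
Qed.

Lemma derive1_add g h : (forall t, derivable g t 1) -> (forall t, derivable h t 1) ->
  derive1 (fun t => g t + h t) = fun t => (derive1 g) t + (derive1 h) t.
Proof. by move=> dg dh; apply/funext => t; rewrite !derive1E deriveD. Qed.

Lemma derive1_mul g h : (forall t, derivable g t 1) -> (forall t, derivable h t 1) ->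
  derive1 (fun t => g t * h t) = fun t => g t * (derive1 h) t + h t * (derive1 g) t.
Proof. by move=> dg dh; apply/funext => t; rewrite !derive1E deriveM. Qed.

Lemma twice_derivableD g h : twice_derivable g -> twice_derivable h ->
  twice_derivable (fun t => g t + h t).
Proof.
move=> [dg dg'] [dh dh']; split => [t|]; first exact: derivableD.
by rewrite (derive1_add dg dh) => t; exact: derivableD.
Qed.

Lemma twice_derivableM g h : twice_derivable g -> twice_derivable h ->
  twice_derivable (fun t => g t * h t).
Proof.
move=> [dg dg'] [dh dh']; split => [t|]; first exact: derivableM.
rewrite (derive1_mul dg dh) => t.
exact: (derivableD (derivableM (dg t) (dh' t)) (derivableM (dh t) (dg' t))).
Qed.

Lemma deriv2_at0D g h : twice_derivable g -> twice_derivable h ->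
  deriv2_at0 (fun t => g t + h t) = deriv2_at0 g + deriv2_at0 h.
Proof.
by move=> [dg dg'] [dh dh']; rewrite /deriv2_at0 (derive1_add dg dh) (derive1_add dg' dh').
Qed.

Lemma deriv2_at0Z c g : twice_derivable g -> deriv2_at0 (fun t => c * g t) = c * deriv2_at0 g.
Proof.
have dc t : derivable (fun _ : R => c) t 1 by exact: derivable_cst.
have D (f : R -> R) : (forall t, derivable f t 1) ->
    derive1 (fun t => c * f t) = fun t => c * (derive1 f) t.
  by move=> df; rewrite (derive1_mul dc df); apply/funext => t; rewrite derive1_cst mulr0 addr0.
by move=> [dg dg']; rewrite /deriv2_at0 (D _ dg) (D _ dg').
Qed.

(** Were the second derivative positive, the first one, which vanishes at 0,
    would be positive right of 0, and g would increase there by the mean value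
    theorem. *)
Lemma deriv2_at0_max g : twice_derivable g ->
  (\forall t \near 0, g t <= g 0) -> deriv2_at0 g <= 0.
Proof.
move=> [dg dg'] /nbhs_ballP[e /= e0 ge]; rewrite leNgt; apply/negP => d2pos.
have g'0 : (derive1 g) 0 = 0.
  rewrite derive1E; apply: derive_val; apply: (@derive1_at_max _ g (- e) e 0) => //.
  - by rewrite (le_trans (ltW _ : - e <= 0)) ?oppr_lt0// ltW.
  - by rewrite in_itv /= oppr_lt0 e0.
  - move=> t; rewrite in_itv /= => /andP[et te]; apply: ge.
    by rewrite /ball /= sub0r normrN ltr_norml et te.
have /cvgr_gt/(_ 0 d2pos) :
    y^-1 *: (derive1 g (y + 0) - derive1 g 0) @[y --> 0^'] --> deriv2_at0 g.
  rewrite -[deriv2_at0 g]/(lim (y^-1 *: (derive1 g (y + 0) - derive1 g 0) @[y --> 0^'])).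
  have := dg' 0; rewrite /derivable (_ : (fun y : R => _) =
    (fun y : R => y^-1 *: (derive1 g (y + 0) - derive1 g 0))) //.
  by apply/funext => y /=; rewrite /shift /= [y *: 1]mulr1.
rewrite /dnbhs near_withinE => /nbhs_ballP[d /= d0 dP].
pose b := Num.min d e / 2.
have b0 : 0 < b by rewrite divr_gt0// lt_min d0 e0.
have bmin : b < Num.min d e by rewrite ltr_pdivrMr// ltr_pMr ?ltr1n// lt_min d0.
have /andP[bd be] : (b < d) && (b < e) by rewrite -lt_min.
have [c] := @MVT R g (derive1 g) 0 b b0 (fun x _ => DeriveDef (dg x) (esym (derive1E g x)))
  (continuous_subspaceT (fun x => differentiable_continuous ((derivable1_diffP g x).1 (dg x)))).
rewrite in_itv /= => /andP[c0 cb] gE.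
have : 0 < derive1 g c.
  rewrite -(pmulr_rgt0 (derive1 g c) (_ : 0 < c^-1)) ?invr_gt0//.
  have := dP c; rewrite addr0 g'0 subr0; apply; last by rewrite gt_eqF.
  by rewrite /ball /= sub0r normrN gtr0_norm// (lt_trans cb bd).
have : g b <= g 0 by apply: ge; rewrite /ball /= sub0r normrN gtr0_norm.
rewrite -subr_le0 gE subr0 => /[swap] gc; apply/negP; rewrite -ltNge.
exact: mulr_gt0.
Qed.
End SecondDerivative.

(** * Left-invariant flows *)

Section LineCalculus.
Context {R : realType} {k : nat}.
Implicit Types (F : 'rV[R]_k -> R) (z v : 'rV[R]_k).

(** The two difference quotients coincide, so derivatives along a line are
    directional derivatives without any chain rule. *)
Lemma line_quotient F z v (t : R) :
  (fun y : R => y^-1 *: (((fun s : R => F (z + s *: v)) \o shift t) (y *: 1) - F (z + t *: v))) =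
  (fun y : R => y^-1 *: ((F \o shift (z + t *: v)) (y *: v) - F (z + t *: v))).
Proof.
apply/funext => y; rewrite /shift /=; congr (_ *: (F _ - _)).
by rewrite [y *: 1]mulr1 scalerDl addrCA.
Qed.

Lemma derivable_line F z v (t : R) : differentiable F (z + t *: v) ->
  derivable (fun s : R => F (z + s *: v)) t 1.
Proof.
move=> dF; have : derivable F (z + t *: v) v by exact: diff_derivable.
by rewrite /derivable line_quotient.
Qed.

Lemma derive1_line F z v (t : R) :
  derive1 (fun s : R => F (z + s *: v)) t = 'D_v F (z + t *: v).
Proof. by rewrite derive1E /derive line_quotient. Qed.

Lemma twice_derivable_line F z v : class_C 2 F ->
  twice_derivable (fun s : R => F (z + s *: v)).
Proof.
move=> [dF /(_ v) [dF' _]]; split=> t; first exact: derivable_line.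
rewrite (_ : derive1 _ = fun s => 'D_v F (z + s *: v)).
  exact: (@derivable_line (fun x => 'D_v F x) z v t (dF' _)).
by apply/funext => s; exact: derive1_line.
Qed.
End LineCalculus.

Section Curves.
Context {R : realType} (G : carnotGroup R).
Local Notation n := (cg_dim G).
Local Notation "x ** y" := (cg_mul G x y) (at level 40).
Implicit Types (x y u : pt G) (f g : pt G -> R).

Definition mulcoord (i : 'I_n) (z : 'rV[R]_(n + n)) : R := (lsubmx z ** rsubmx z) 0 i.

Lemma mulcoordE i x y : (x ** y) 0 i = mulcoord i (row_mx x y).
Proof. by rewrite /mulcoord row_mxKl row_mxKr. Qed.

Lemma class_mulcoord k i : class_C k (mulcoord i).
Proof. exact: cg_mul_smooth. Qed.

Lemma continuous_mul (X : topologicalType) (a b : X -> pt G) :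
  continuous a -> continuous b -> continuous (fun z => a z ** b z).
Proof.
move=> ca cb; apply: continuous_row => i.
rewrite (_ : (fun z => _) = mulcoord i \o (fun z => row_mx (a z) (b z))); last first.
  by apply/funext => z; rewrite mulcoordE.
move=> z.
apply: (@continuous_comp _ _ _ (fun z => row_mx (a z) (b z)) (mulcoord i)).
  exact: continuous_rowmx.
exact: (class_mulcoord 0 i).
Qed.

(** The flow of a left-invariant field is an affine line, followed by the
    group law. *)
Lemma mul_line x u (t : R) i :
  (x ** (t *: u)) 0 i = mulcoord i (row_mx x 0 + t *: row_mx 0 u).
Proof. by rewrite mulcoordE scale_row_mx add_row_mx scaler0 addr0 add0r. Qed.

Lemma mul_curveD x u (s t : R) : x ** ((s + t) *: u) = (x ** (t *: u)) ** (s *: u).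
Proof. by rewrite -cg_mulA cg_exp addrC. Qed.

Lemma mulNx x : (- x) ** x = 0.
Proof. by have := cg_exp (c:=G) x (-1) 1; rewrite scaleN1r scale1r addNr scale0r. Qed.

Lemma mulxN x : x ** (- x) = 0.
Proof. by have := cg_exp (c:=G) x 1 (-1); rewrite scaleN1r scale1r addrN scale0r. Qed.

Lemma lvf_curve u f x (t : R) :
  lvf (cg_mul G) u f (x ** (t *: u)) = derive1 (fun s => f (x ** (s *: u))) t.
Proof.
rewrite -[in RHS](addr0 t) derive1_shift /lvf.
by under [in RHS]eq_fun do rewrite mul_curveD.
Qed.

(** The flow of u is a one-parameter group, so applying its field twice
    amounts to differentiating twice along a single flow line. *)
Lemma lvf_lvf u f x :
  lvf (cg_mul G) u (lvf (cg_mul G) u f) x = deriv2_at0 (fun t => f (x ** (t *: u))).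
Proof. by rewrite {1}/lvf /deriv2_at0; under eq_fun do rewrite lvf_curve. Qed.

(** The regularity under which the sub-Laplacian is additive. *)
Definition flow_C2 f := forall x u, twice_derivable (fun t => f (x ** (t *: u))).

(** The sub-Laplacian of a real function, as it reads by lvf_lvf. *)
Definition flow_laplacian (X : 'M[R]_(layer_dim G 1, n)) f x : R :=
  \sum_a deriv2_at0 (fun t => f (x ** (t *: row a X))).

Lemma flow_C2_cst c : flow_C2 (fun=> c).
Proof. by move=> x u; exact: twice_derivable_cst. Qed.
Lemma flow_C2D f g : flow_C2 f -> flow_C2 g -> flow_C2 (fun x => f x + g x).
Proof. by move=> Cf Cg x u; exact: twice_derivableD. Qed.
Lemma flow_C2M f g : flow_C2 f -> flow_C2 g -> flow_C2 (fun x => f x * g x).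
Proof. by move=> Cf Cg x u; exact: twice_derivableM. Qed.
Lemma flow_C2_coord i : flow_C2 (fun x => x 0 i).
Proof.
move=> x u; under eq_fun do rewrite mul_line.
exact: twice_derivable_line (class_mulcoord 2 i).
Qed.

Lemma flow_laplacianD X f g x : flow_C2 f -> flow_C2 g ->
  flow_laplacian X (fun y => f y + g y) x = flow_laplacian X f x + flow_laplacian X g x.
Proof.
move=> Cf Cg; rewrite /flow_laplacian -big_split; apply: eq_bigr => a _.
exact: deriv2_at0D (Cf x _) (Cg x _).
Qed.

Lemma flow_laplacianZ X c f x : flow_C2 f ->
  flow_laplacian X (fun y => c * f y) x = c * flow_laplacian X f x.
Proof.
move=> Cf; rewrite /flow_laplacian mulr_sumr; apply: eq_bigr => a _.
exact: deriv2_at0Z (Cf x _).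
Qed.

Lemma Re_sublaplacian X (p : pt G -> R[i]) x :
  complex.Re (sublaplacian X p x) = flow_laplacian X (fun y => complex.Re (p y)) x.
Proof. by rewrite Re_sum; apply: eq_bigr => a _; exact: lvf_lvf. Qed.

Lemma Im_sublaplacian X (p : pt G -> R[i]) x :
  complex.Im (sublaplacian X p x) = flow_laplacian X (fun y => complex.Im (p y)) x.
Proof. by rewrite Im_sum; apply: eq_bigr => a _; exact: lvf_lvf. Qed.

Lemma polynomial_parts_ind (Q : (pt G -> R) -> Prop) :
  (forall c, Q (fun=> c)) -> (forall i, Q (fun x => x 0 i)) ->
  (forall f g, Q f -> Q g -> Q (fun x => f x + g x)) ->
  (forall f g, Q f -> Q g -> Q (fun x => f x * g x)) ->
  forall p : pt G -> R[i], polynomial_fun p ->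
    Q (fun x => complex.Re (p x)) /\ Q (fun x => complex.Im (p x)).
Proof.
move=> Qc Qx QD QM.
pose QC (p : pt G -> R[i]) := Q (fun x => complex.Re (p x)) /\ Q (fun x => complex.Im (p x)).
have QCc c : QC (fun=> c) by split; exact: Qc.
have QCD p q : QC p -> QC q -> QC (fun x => p x + q x).
  move=> [pr pi] [qr qi]; split.
    by under eq_fun do rewrite ReD; exact: QD.
  by under eq_fun do rewrite ImD; exact: QD.
have QCM p q : QC p -> QC q -> QC (fun x => p x * q x).
  move=> [pr pi] [qr qi]; split.
    under eq_fun do rewrite ReM -mulN1r.
    by apply: QD; [exact: QM|apply: (QM); [exact: Qc|exact: QM]].
  under eq_fun do rewrite ImM.
  by apply: QD; exact: QM.
have QCX i e : QC (fun x => complex_coords x i ^+ e).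
  elim: e => [|e IH]; first exact: QCc.
  by under eq_fun do rewrite exprS; apply: QCM => //; split; [exact: Qx|exact: Qc].
have QCm m : QC (monom m).
  rewrite /monom; elim: (index_enum _) => [|i s IH].
    by under eq_fun do rewrite big_nil; exact: QCc.
  by under eq_fun do rewrite big_cons; exact: QCM.
move=> _ [q ->].
suff : QC (fun x => mpoly.meval (complex_coords x) q) by [].
under eq_fun do rewrite mevalE.
elim: (mpoly.msupp q) => [|m s IH].
  by under eq_fun do rewrite big_nil; exact: QCc.
by under eq_fun do rewrite big_cons; apply: QCD => //; exact: QCM.
Qed.

Lemma polynomial_flow_C2 (p : pt G -> R[i]) : polynomial_fun p ->
  flow_C2 (fun x => complex.Re (p x)) /\ flow_C2 (fun x => complex.Im (p x)).
Proof.
apply: polynomial_parts_ind;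
  [exact: flow_C2_cst|exact: flow_C2_coord|exact: flow_C2D|exact: flow_C2M].
Qed.

Lemma polynomial_continuous (p : pt G -> R[i]) : polynomial_fun p ->
  continuous (fun x => complex.Re (p x)) /\ continuous (fun x => complex.Im (p x)).
Proof.
apply: (@polynomial_parts_ind (fun f => continuous f)).
- by move=> c; exact: cst_continuous.
- by move=> i x; exact: (@coord_continuous R 1 n 0 i x).
- by move=> f g cf cg x; exact: (continuousD (cf x) (cg x)).
- by move=> f g cf cg x; exact: (continuousM (cf x) (cg x)).
Qed.

Lemma continuous_dil_r x : continuous (fun r : R => dil r x).
Proof. by apply: continuous_wdil; [move=> r; exact: cvg_id|exact: cst_continuous]. Qed.

Lemma dil0 x : dil (G := G) 0 x = 0.
Proof.
apply/rowP => i; rewrite !mxE; have /andP[w _] := cg_wt_range i.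
by rewrite expr0n gtn_eqF// mul0r.
Qed.

Lemma dilM (r s : R) x : dil r (dil s x) = dil (r * s) x.
Proof. by apply/rowP => i; rewrite !mxE exprMn mulrA. Qed.

Lemma dil1 x : dil 1 x = x.
Proof. by apply/rowP => i; rewrite !mxE expr1n mul1r. Qed.

(** The derivative psi of a coordinate of weight 1 along a field of the first
    layer is invariant under dilations. As it is continuous, it takes at x its value
    at the origin, which is the limit of dil r x when r tends to 0. *)
Lemma lvf_coord u i x : layer 1 u -> cg_wt G i = 1%N ->
  lvf (cg_mul G) u (fun y => y 0 i) x = u 0 i.
Proof.
move=> u1 wi; set psi := lvf _ _ _.
have psiE y : psi y = 'D_(row_mx 0 u) (mulcoord i) (row_mx y 0).
  rewrite /psi /lvf; under eq_fun do rewrite mul_line.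
  by rewrite derive1_line scale0r addr0.
have cpsi : continuous psi.
  rewrite (_ : psi = fun y => 'D_(row_mx 0 u) (mulcoord i) (row_mx y 0)); last exact/funext.
  have [_ /(_ (row_mx 0 u)) cD] := class_mulcoord 1 i.
  move=> y; apply: (@continuous_comp _ _ _ (fun y : pt G => row_mx y 0)
    (fun z => 'D_(row_mx 0 u) (mulcoord i) z)); last exact: cD.
  apply: continuous_rowmx; [by move=> z; exact: cvg_id|exact: cst_continuous].
have psi_dil r y : 0 < r -> psi (dil r y) = psi y.
  move=> r0.
  have dilu (t : R) : (r * t) *: u = dil r (t *: u).
    apply/rowP => j; rewrite !mxE; have [->|wj] := eqVneq (cg_wt G j) 1%N.
      by rewrite mulrA.
    by rewrite (u1 j wj) !mulr0.
  have dF z : differentiable (mulcoord i) z by have [] := class_mulcoord 1 i.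
  apply: (mulfI (lt0r_neq0 r0)).
  have <- : derive1 (fun t => (dil r y ** (t *: (r *: u))) 0 i) 0 = r * psi (dil r y).
    under eq_fun do rewrite mul_line.
    rewrite derive1_line scale0r addr0 psiE !deriveE//.
    rewrite (_ : row_mx 0 (r *: u) = r *: row_mx 0 u) ?linearZ//.
    by rewrite scale_row_mx scaler0.
  under eq_fun => t do rewrite scalerA [t * r]mulrC dilu -[dil r y]/(wdil _ _ _)
    -[dil r _]/(wdil _ _ _) -cg_dilM// mxE wi expr1.
  have [dg _] := flow_C2_coord i y u.
  rewrite (derive1_mul (fun t => derivable_cst r t 1) dg) derive1_cst mulr0 addr0.
  by [].
have <- : psi 0 = u 0 i.
  rewrite /psi /lvf; under eq_fun do rewrite cg_mul0x mxE.
  by rewrite derive1Mr ?derive1_id ?mul1r//; exact: derivable_id.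
have c1 : psi (dil r x) @[r --> 0^'+] --> psi 0.
  apply: cvg_at_right_filter; rewrite -[X in _ --> psi X](dil0 x).
  apply: (@continuous_comp _ _ _ (fun r => dil r x) psi); first exact: continuous_dil_r.
  exact: cpsi.
have c2 : psi (dil r x) @[r --> 0^'+] --> psi x.
  apply: cvg_near_cst; near=> r; apply: psi_dil.
  by near: r; exact: nbhs_right_gt.
exact: cvg_unique c2 c1.
Unshelve. all: by end_near. Qed.

End Curves.

(** * The weak maximum principle *)

Section MaximumPrinciple.
Context {R : realType} (G : carnotGroup R).
Local Notation n := (cg_dim G).
Local Notation "x ** y" := (cg_mul G x y) (at level 40).
Variables (X : 'M[R]_(layer_dim G 1, n)) (N : pt G -> R).
Hypotheses (bX : basis_V1 X) (gN : gauge N).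
Implicit Types (x y u : pt G) (f g : pt G -> R).

Lemma gauge_ge0 x : 0 <= N x.
Proof.
have [_ _ N0 Npos _] := gN; have [->|/Npos/ltW//] := eqVneq x 0.
by rewrite N0.
Qed.

Lemma row_layer1 a : layer 1 (row a X).
Proof. by apply/bX.2; exact: row_sub. Qed.

(** The square of a coordinate of weight 1 is the strict subsolution of the
    maximum principle: its sub-Laplacian is a positive constant. *)
Lemma flow_laplacian_sqr i x : cg_wt G i = 1%N ->
  flow_laplacian X (fun y => y 0 i * y 0 i) x = 2 * \sum_a X a i ^+ 2.
Proof.
move=> wi; rewrite mulr_sumr; apply: eq_bigr => a _.
set u := row a X; pose g t := (x ** (t *: u)) 0 i.
have [dg _] : twice_derivable g by exact: flow_C2_coord.
have g' : derive1 g = fun=> X a i.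
  apply/funext => t; rewrite -(lvf_curve u (fun y => y 0 i)) lvf_coord//.
    by rewrite mxE.
  exact: row_layer1.
rewrite /deriv2_at0 -[fun t => _]/(fun t => g t * g t) (derive1_mul dg dg) g'.
have dZ t : derivable (fun t => g t * X a i) t 1.
  exact: derivableM (dg t) (derivable_cst _ _ _).
rewrite (derive1_add dZ dZ) derive1Mr// g' expr2; ring.
Qed.

Lemma sum_sqr_layer1_gt0 i : cg_wt G i = 1%N -> 0 < \sum_a X a i ^+ 2.
Proof.
move=> wi; rewrite lt_neqAle sumr_ge0 ?andbT; last by move=> a _; exact: sqr_ge0.
apply/negP; rewrite eq_sym psumr_eq0; last by move=> a _; exact: sqr_ge0.
move=> /allP X0.
have /bX.2/submxP[D DE] : layer 1 (delta_mx 0 i : pt G).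
  by move=> j wj; rewrite mxE eqxx /=; case: eqP => // ji; rewrite ji wi in wj.
have := congr1 (fun M : 'rV_n => M 0 i) DE; rewrite !mxE !eqxx big1 => [/eqP|a _].
  by rewrite oner_eq0.
have := X0 a (mem_index_enum a); rewrite sqrf_eq0 => /eqP ->.
by rewrite mulr0.
Qed.

(** If f were positive at a point x0 of the ball, then f + e * x_i ^ 2, for e
    small, would reach its maximum on the ball inside it. There all second
    derivatives along flows are nonpositive, whereas their sum is e times a positive
    constant. *)
Lemma weak_maximum_principle f : flow_C2 f -> continuous f ->
  (forall x, flow_laplacian X f x = 0) -> (forall x, N x = 1 -> f x <= 0) ->
  forall x, N x <= 1 -> f x <= 0.
Proof.
move=> Cf cf Lf fS x0 Nx0; rewrite leNgt; apply/negP => fx0.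
have [cN pN _ _ _] := gN.
have [i wi] := cg_V1_neq0 G.
pose v y : R := y 0 i * y 0 i.
have Cv : flow_C2 v by exact: (flow_C2M (flow_C2_coord i) (flow_C2_coord i)).
have cx : continuous (fun y : pt G => y 0 i).
  by move=> y; exact: (@coord_continuous R 1 n 0 i y).
have cv : continuous v by move=> y; exact: (continuousM (cx y) (cx y)).
pose K := N @^-1` `[0, 1]%classic.
have KE x : K x = (N x <= 1) :> Prop.
  by rewrite /K /= in_itv /= gauge_ge0.
have cK : compact K by apply: pN; exact: segment_compact.
have K0 : K !=set0 by exists x0; rewrite KE.
have [c _ vc] := compact_EVT_max K0 cK (continuous_subspaceT cv).
have v0 t : 0 <= v t by rewrite /v -expr2 sqr_ge0.
have vc0 : 0 <= v c by exact: v0.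
(* small enough for e * v to stay below f x0 on the ball *)
pose e := f x0 / (v c + 1).
have vc1 : 0 < v c + 1 by rewrite ltr_wpDl.
have e0 : 0 < e by rewrite divr_gt0.
have ev t : K t -> e * v t < f x0.
  move=> Kt; rewrite /e mulrAC ltr_pdivrMr// ltr_pM2l//.
  by rewrite (le_lt_trans (vc t _)) ?inE// ltrDl.
pose w y := f y + e * v y.
have Cev : flow_C2 (fun y => e * v y) by exact: (flow_C2M (flow_C2_cst e) Cv).
have Cw : flow_C2 w by exact: (flow_C2D Cf Cev).
have cev : continuous (fun y => e * v y).
  exact: (continuous_comp_fun cv (@mulrl_continuous R e)).
have cw : continuous w by move=> y; exact: (continuousD (cf y) (cev y)).
have [y yK wy] := compact_EVT_max K0 cK (continuous_subspaceT cw).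
rewrite inE in yK; have Ny : N y < 1.
  rewrite lt_neqAle; apply/andP; split; last by rewrite -KE.
  apply/eqP => Ny; have := fS y Ny; apply/negP; rewrite -ltNge.
  have wx0 : w x0 <= w y by apply: wy; rewrite inE KE.
  have vx0 : f x0 <= w x0 by rewrite lerDl; apply: mulr_ge0; [exact: ltW|exact: v0].
  rewrite -(ltrD2r (e * v y)) add0r (lt_le_trans (ev y yK))//.
  exact: le_trans vx0 wx0.
have : flow_laplacian X w y <= 0.
  apply: sumr_le0 => a _; apply: deriv2_at0_max; first exact: Cw.
  have cc : continuous (fun t : R => N (y ** (t *: row a X))).
    have c1 : continuous (fun t : R => y ** (t *: row a X)).
      by apply: continuous_mul; [exact: cst_continuous|exact: continuous_scale_row].
    exact: (continuous_comp_fun c1 cN).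
  have Nlt : N (y ** (0 *: row a X)) < 1 by rewrite scale0r cg_mulx0.
  have near1 : \forall t \near (0 : R), N (y ** (t *: row a X)) < 1.
    exact: cvgr_lt (cc 0) _ Nlt.
  near=> t; rewrite scale0r cg_mulx0; apply: wy; rewrite inE KE ltW//.
  by near: t.
rewrite (flow_laplacianD _ _ Cf Cev) (flow_laplacianZ _ _ _ Cv) Lf add0r flow_laplacian_sqr//.
by rewrite leNgt mulr_gt0// mulr_gt0// sum_sqr_layer1_gt0.
Unshelve. all: by end_near. Qed.
End MaximumPrinciple.

(** * Harmonic polynomials on the sphere *)

Section Harmonic.
Context {R : realType} (G : carnotGroup R).
Local Notation n := (cg_dim G).
Variables (X : 'M[R]_(layer_dim G 1, n)).

Definition harmonic : set (pt G -> R[i]) :=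
  [set p | polynomial_fun p /\ sublaplacian X p = fun=> 0].

Lemma harmonicP p : polynomial_fun p -> (sublaplacian X p = fun=> 0) <->
  (forall x, flow_laplacian X (fun y => complex.Re (p y)) x = 0) /\
  (forall x, flow_laplacian X (fun y => complex.Im (p y)) x = 0).
Proof.
move=> pp; split=> [p0|[pr pi]].
  by split=> x; rewrite -(Re_sublaplacian, Im_sublaplacian) p0.
by apply/funext => x; apply: complexP; rewrite (Re_sublaplacian, Im_sublaplacian).
Qed.

Lemma subspace_polynomial : subspace (@polynomial_fun R G).
Proof.
split; first by exists 0; apply/funext => x; rewrite mpoly.meval0.
move=> a f g [p ->] [q ->]; exists (a *: p + q).
by apply/funext => x; rewrite mpoly.mevalD mpoly.mevalZ.
Qed.

Lemma subspace_harmonic : subspace harmonic.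
Proof.
have cc (c : R) : flow_C2 (fun _ : pt G => c) := @flow_C2_cst R G c.
split.
  have pol0 := subspace_polynomial.1; split; first exact: pol0.
  apply/(harmonicP pol0).
  by split=> x; apply: big1 => a _; rewrite /deriv2_at0 (_ : derive1 _ = fun=> 0)
      ?derive1_cst//;
    apply/funext => t; rewrite derive1_cst.
move=> a f g [pf hf] [pg hg].
have pS := subspace_polynomial.2 a _ _ pf pg; split; first exact: pS.
have [Cfr Cfi] := polynomial_flow_C2 pf; have [Cgr Cgi] := polynomial_flow_C2 pg.
have [fr fi] := (harmonicP pf).1 hf; have [gr gi] := (harmonicP pg).1 hg.
have CZ c (h : pt G -> R) : flow_C2 h -> flow_C2 (fun x => c * h x).
  exact: flow_C2M (cc c).
apply/(harmonicP pS); split=> x.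
  rewrite (_ : (fun y => _) = fun y => (complex.Re a * complex.Re (f y) +
     - complex.Im a * complex.Im (f y)) + complex.Re (g y)); last first.
    by apply/funext => y; rewrite !partsE mulNr.
  rewrite (flow_laplacianD _ _ (flow_C2D (CZ _ _ Cfr) (CZ _ _ Cfi)) Cgr).
  rewrite (flow_laplacianD _ _ (CZ _ _ Cfr) (CZ _ _ Cfi)).
  by rewrite (flow_laplacianZ _ _ _ Cfr) (flow_laplacianZ _ _ _ Cfi) fr fi gr !mulr0 !addr0.
rewrite (_ : (fun y => _) = fun y => (complex.Re a * complex.Im (f y) +
   complex.Im a * complex.Re (f y)) + complex.Im (g y)); last first.
  by apply/funext => y; rewrite !partsE.
rewrite (flow_laplacianD _ _ (flow_C2D (CZ _ _ Cfi) (CZ _ _ Cfr)) Cgi).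
rewrite (flow_laplacianD _ _ (CZ _ _ Cfi) (CZ _ _ Cfr)).
by rewrite (flow_laplacianZ _ _ _ Cfr) (flow_laplacianZ _ _ _ Cfi) fr fi gi !mulr0 !addr0.
Qed.

Lemma subspace_Hm m : subspace (Hm X m).
Proof.
have [z0 zD] := @subspace_Pm R G m; have [h0 hD] := subspace_harmonic.
split; first by split; [exact: z0|exact: h0.2].
move=> a f g [Pf Lf] [Pg Lg]; split; first exact: zD.
by have [] := hD a f g (conj Pf.1 Lf) (conj Pg.1 Lg).
Qed.

Lemma psum_Hm_harmonic k : psum (Hm X) k `<=` harmonic.
Proof.
by apply: psum_sub subspace_harmonic _ => j _ p [[pp _] ?].
Qed.

Variable N : pt G -> R.
Hypotheses (bX : basis_V1 X) (gN : gauge N).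

(** The maximum principle applies to the real and imaginary parts and to
    their opposites. *)
Lemma harmonic_eq0 p : harmonic p -> (forall x, N x = 1 -> p x = 0) ->
  forall x, N x <= 1 -> p x = 0.
Proof.
move=> [pp hp] pS x Nx.
have [Cr Ci] := polynomial_flow_C2 pp; have [cr ci] := polynomial_continuous pp.
have [Lr Li] := (harmonicP pp).1 hp.
have key (f : pt G -> R) : flow_C2 f -> continuous f ->
    (forall x, flow_laplacian X f x = 0) -> (forall x, N x = 1 -> f x = 0) -> f x = 0.
  move=> Cf cf Lf fS; apply/eqP; rewrite eq_le.
  rewrite (weak_maximum_principle bX gN Cf cf Lf)//=; last by move=> y /fS ->.
  have CN : flow_C2 (fun y => -1 * f y) by exact: (flow_C2M (@flow_C2_cst R G (-1)) Cf).
  have cNf : continuous (fun y => -1 * f y).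
    exact: (continuous_comp_fun cf (@mulrl_continuous R (-1))).
  rewrite -oppr_le0 -mulN1r; apply: (weak_maximum_principle bX gN CN cNf); last exact: Nx.
    by move=> y; rewrite (flow_laplacianZ _ _ _ Cf) Lf mulr0.
  by move=> y /fS ->; rewrite mulr0.
apply: complexP.
  by apply: (key _ Cr cr Lr) => y /pS ->.
by apply: (key _ Ci ci Li) => y /pS ->.
Qed.

(** The sum of the h j vanishes on the whole ball, hence at dil r x for all
    small r; there it is a polynomial in r with coefficients h j x. *)
Lemma Hm_direct_sphere k (h : nat -> pt G -> R[i]) : (forall j, (j < k)%N -> Hm X j (h j)) ->
  (forall x, N x = 1 -> \sum_(j < k) h j x = 0) ->
  forall j, (j < k)%N -> h j = fun=> 0.
Proof.
move=> Hh hS j jk; apply/funext => x.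
have hh : harmonic (fun x => \sum_(j < k) h j x).
  by apply: (@psum_Hm_harmonic k); exists h.
have h0 := harmonic_eq0 hh hS.
pose P : {poly R[i]} := \sum_(j < k) h j x *: 'X^j.
have P0 : P = 0.
  apply: (@poly_eq0_near _ P (N x + 1)^-1); first by rewrite invr_gt0 ltr_wpDl// gauge_ge0.
  move=> r /andP[r0 rN].
  have Nr : N (dil r x) <= 1.
    have [_ _ _ _ ->//] := gN.
    have N1 : 0 < N x + 1 by rewrite ltr_wpDl// gauge_ge0.
    rewrite (@le_trans _ _ (r * (N x + 1)))// ?ler_pM2l ?lerDl//.
    by rewrite -ler_pdivlMr// div1r ltW.
  rewrite horner_sum -[RHS](h0 _ Nr); apply: eq_bigr => i _.
  by have [[_ ->//] _] := Hh i (ltn_ord i); rewrite !hornerE complexrX mulrC.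
have := congr1 (fun P : {poly R[i]} => P`_j) P0.
rewrite coef0 /P coef_sum (bigD1 (Ordinal jk))//= coefZ coefXn eqxx mulr1.
rewrite big1 ?addr0// => i ij; rewrite coefZ coefXn; case: eqP => [ji|_]; last by rewrite mulr0.
by move: ij; rewrite -val_eqE /= ji eqxx.
Qed.

End Harmonic.

(** * The support of the polar measure *)

Section BorelRow.
Context {R : realType} (G : carnotGroup R).
Local Notation n := (cg_dim G).

Lemma open_borel (A : set (pt G)) : open A -> measurable (A : set (borel G)).
Proof. by move=> oA; apply: sub_sigma_algebra. Qed.

Lemma continuous_borel (f : pt G -> R) : continuous f ->
  measurable_fun setT (f : borel G -> R).
Proof.
move=> cf; apply: (measurability _ (RGenOInfty.measurableE R)).
move=> _ [_ [a ->] <-]; rewrite setTI; apply: open_borel.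
by move/continuousP : cf; apply; exact: interval_open.
Qed.

Lemma rational_point (A : set (pt G)) : open A -> A !=set0 ->
  exists q : 'rV[rat]_n, A (map_mx ratr q).
Proof.
move=> oA [x Ax]; have /nbhs_ballP[e /= e0 eA] := open_nbhs_nbhs (conj oA Ax).
have /choice[q qP] : forall i, exists q : rat, ratr q \in `](x 0 i - e), (x 0 i + e)[.
  by move=> i; apply: rat_in_itvoo; rewrite ltrBlDr -addrA ltrDl addr_gt0.
exists (\row_i q i); apply: eA; split => // a i; rewrite ord1 !mxE.
have := qP i; rewrite in_itv /= => /andP[q1 q2].
by rewrite /ball /= ltr_distlC q1.
Qed.

End BorelRow.

Section FullSupport.
Context {R : realType} (G : carnotGroup R).
Local Notation n := (cg_dim G).
Local Notation "x ** y" := (cg_mul G x y) (at level 40).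
Variable mu : {measure set (borel G) -> \bar R}.
Hypothesis hmu : haar mu.

(** Countably many translates of V, by rational points, cover the group and
    have the measure of V. *)
Lemma haar_open (V : set (pt G)) : open V -> V !=set0 -> mu (V : set (borel G)) <> 0%E.
Proof.
move=> oV [v Vv] V0; have [_ muT muI] := hmu; apply: muT.
pose tr q : set (borel G) := cg_mul G (map_mx ratr q) @` V.
pose F k : set (borel G) := if unpickle k is Some q then tr (q : 'rV[rat]_n) else set0.
have trE (q : pt G) : cg_mul G q @` V = (fun z => (- q) ** z) @^-1` V.
  apply/seteqP; split => [_ [z Vz <-]|z Vz] /=.
    by rewrite cg_mulA mulNx cg_mul0x.
  by exists ((- q) ** z) => //; rewrite cg_mulA mulxN cg_mul0x.
have mF k : measurable (F k).
  rewrite /F; case: unpickle => [q|]; last exact: measurable0.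
  apply: open_borel; rewrite /tr trE; apply: open_comp => // z _.
  apply: (@continuous_mul R G _ (fun _ => - map_mx ratr q) id).
    exact: cst_continuous.
  by move=> y; exact: cvg_id.
have F0 k : mu (F k) = 0%E.
  rewrite /F; case: unpickle => [q|]; last exact: measure0.
  by rewrite -[RHS]V0; exact: muI (open_borel oV).
have : mu.-negligible (\bigcup_k F k).
  apply: negligible_bigcup => k; exact: (negligibleP mu (mF k)).2 (F0 k).
suff -> : \bigcup_k F k = setT by move/negligibleP => -> //; exact: measurableT.
apply/seteqP; split => // y _.
have [||q Vq] := @rational_point R G ((fun z : pt G => (- z) ** y) @^-1` V).
- apply: open_comp => // z _.
  have cm : continuous (fun z : pt G => (- z) ** y).
    by apply: continuous_mul; [exact: opp_continuous|exact: cst_continuous].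
  exact: cm.
- by exists (- (v ** (- y))); rewrite /= opprK -cg_mulA mulNx cg_mulx0.
exists (pickle q) => //; rewrite /F pickleK /tr trE.
exact: Vq.
Qed.

Variables (N : pt G -> R) (sigma : {finite_measure set (borel G) -> \bar R}).
Hypotheses (gN : gauge N) (pol : polar_measure mu N sigma).

(** Extend psi from the sphere to the group by making it constant along
    dilations, and cut it off near 0 and infinity. The integral of this function f is
    0 in polar coordinates, hence f vanishes outside a Haar null set, and such a set
    contains no nonempty open set. *)
Lemma polar_full_support (psi : pt G -> R) : continuous psi -> (forall x, 0 <= psi x) ->
  {ae sigma, forall x, sphere N x -> psi x = 0} -> forall x, N x = 1 -> psi x = 0.
Proof.
move=> cpsi psi0 pae x0 Nx0; apply/eqP/negPn/negP => px0.
have [cN pN _ _ Ndil] := gN.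
(* b s is s where phi s is not 0, and never 0, so that f is continuous at 0 too *)
pose b (s : R) := Num.max s (2^-1).
pose phi (s : R) := Num.max 0 ((s - 2^-1) * (2 - s)).
have cb : continuous b.
  move=> s; apply: (@continuous_max R R id (fun=> 2^-1)); [exact: cvg_id|exact: cvg_cst].
have cphi : continuous phi.
  move=> s; apply: (@continuous_max R R (fun=> 0) (fun s => (s - 2^-1) * (2 - s))).
    exact: cvg_cst.
  apply: cvgM; apply: cvgB; by [exact: cvg_id|exact: cvg_cst].
have bpos s : 0 < b s by rewrite /b lt_max invr_gt0 ltr0n orbT.
pose f x := phi (N x) * psi (dil (b (N x))^-1 x).
have cf : continuous f.
  have c1 : continuous (fun x => phi (N x)) := continuous_comp_fun cN cphi.
  have c2 : continuous (fun x => (b (N x))^-1).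
    have cbN := continuous_comp_fun cN cb.
    move=> x; apply: (@continuous_comp _ _ _ (fun x => b (N x)) (@GRing.inv R)).
      exact: cbN.
    by apply: inv_continuous; rewrite gt_eqF.
  have c3 : continuous (fun x : pt G => dil (b (N x))^-1 x).
    by apply: continuous_wdil => // y; exact: cvg_id.
  have c4 := continuous_comp_fun c3 cpsi.
  by move=> x; exact: (continuousM (c1 x) (c4 x)).
have phi_out s : ~~ (2^-1 < s < 2) -> phi s = 0.
  move=> h; apply/max_idPl; move: h; rewrite negb_and -!leNgt => /orP[h|h].
    have h2 : s <= 2 by lra.
    by rewrite mulr_le0_ge0// ?subr_le0 ?subr_ge0.
  have h2 : 2^-1 <= s by lra.
  by rewrite mulr_ge0_le0// ?subr_le0 ?subr_ge0.
have f0 x : 0 <= f x by rewrite mulr_ge0// /phi le_max lexx.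
have fpol r w : 0 < r -> N w = 1 -> f (dil r w) = phi r * psi w.
  move=> r0 Nw; rewrite /f Ndil// Nw mulr1.
  have [rin|/phi_out ->] := boolP (2^-1 < r < 2); last by rewrite !mul0r.
  have /andP[r1 r2] := rin.
  by rewrite (_ : b r = r) ?dilM ?mulVf ?dil1 ?gt_eqF//; apply/max_idPl/ltW.
have intf : (\int[mu]_x (f x)%:E = 0)%E.
  rewrite (pol.2 f cf).
    apply: integral0_eq => r; rewrite /= in_itv /= andbT => r0.
    rewrite (_ : (\int[sigma]_(w in sphere N) _ = 0)%E) ?mul0e//.
    have mS : measurable (sphere N : set (borel G)).
      have -> : sphere N = ~` (N @^-1` (~` [set 1])).
        by apply/seteqP; split => x /=; [move=> -> /=|move/contrapT].
      apply: measurableC; apply: open_borel.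
      by move/continuousP : cN; apply; apply: closed_openC; exact: closed_eq.
    rewrite (ae_eq_integral (cst 0%E)) ?integral0//.
      apply/measurable_EFinP; apply: measurable_funTS; apply: continuous_borel.
      apply: (@continuous_comp_fun _ _ _ (fun w => dil r w) f) => //.
      by apply: continuous_wdil; [exact: cst_continuous|move=> y; exact: cvg_id].
    apply: (@filterS _ _ (ae_filter_ringOfSetsType sigma) _ _ _ pae) => w wP Sw /=.
    by rewrite fpol// wP// mulr0.
  exists (N @^-1` `[2^-1, 2]%classic); split.
  - by apply: pN; exact: segment_compact.
  - by have [_ _ N0 _ _] := gN; rewrite /= in_itv /= N0 => /andP[];
      rewrite leNgt invr_gt0 ltr0n.
  - move=> x /= Kx; rewrite /f phi_out ?mul0r//; apply/negP => /andP[h1 h2].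
    by apply: Kx; rewrite in_itv /= !ltW.
have mf : measurable_fun setT (fun x : borel G => (f x)%:E).
  by apply/measurable_EFinP; exact: continuous_borel.
have : (\int[mu]_x `|(f x)%:E| = 0)%E.
  rewrite -[RHS]intf; apply: eq_integral => x _ /=.
  by rewrite ger0_norm.
move/(ae_eq_integral_abs mu measurableT mf) => [A [mA A0 fA]].
have oV : open (f @^-1` (~` [set 0])).
  by move/continuousP : cf; apply; apply: closed_openC; exact: closed_eq.
apply: (@haar_open (f @^-1` (~` [set 0]))) => //.
  exists x0; rewrite /= /f Nx0 (_ : b 1 = 1); last first.
    by apply/max_idPl; rewrite invf_le1 ?ler1n ?ltr0n.
  rewrite invr1 dil1 => /eqP; rewrite mulf_eq0 (negbTE px0) orbF.
  rewrite /phi (_ : Num.max _ _ = 2^-1); first by rewrite invr_eq0 pnatr_eq0.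
  have -> : (1 - 2^-1) * (2 - 1) = 2^-1 :> R by lra.
  by apply/max_idPr; rewrite invr_ge0 ler0n.
apply: (subset_measure0 _ mA) => //; first exact: open_borel.
by move=> x /= fx; apply: fA => /= /(_ I) [].
Qed.

End FullSupport.

(** * Closures of subspaces in L2 *)

Definition cplx {R : realType} {T : Type} (u : T -> R) : T -> R[i] := fun x => Complex (u x) 0.

Lemma normsq_cplx (R : realType) (r : R) : normsq (Complex r 0) = r ^+ 2.
Proof. by rewrite /normsq /= expr0n /= addr0. Qed.

Lemma normsq_cplxB (R : realType) (r s : R) :
  normsq (Complex r 0 - Complex s 0) = (r - s) ^+ 2.
Proof. by rewrite /normsq !partsE /= subr0 expr0n /= addr0. Qed.

Section Closure.
Context d (T : measurableType d) (R : realType) (mu : {measure set T -> \bar R}).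
Implicit Types (f g h : T -> R[i]) (u v : T -> R).

Lemma sqnormD f g : L2 mu f -> L2 mu g ->
  sqnorm mu (fun x => f x + g x) <= 2 * sqnorm mu f + 2 * sqnorm mu g.
Proof.
move=> Lf Lg; have If := L2_integrable Lf; have Ig := L2_integrable Lg.
have IZ F : mu.-integrable setT (EFin \o F) ->
    mu.-integrable setT (EFin \o (fun x => 2 * F x)).
  by move=> iF; apply: (integrableZl measurableT 2 iF).
rewrite /sqnorm -!RintegralZl// -RintegralD//; [|exact: IZ|exact: IZ].
apply: le_Rintegral => //.
- exact: L2_integrable (subspaceD (subspaceL2 mu) Lf Lg).
- exact: (integrableD measurableT (IZ _ If) (IZ _ Ig)).
- by move=> x _; exact: normsqD.
Qed.

Lemma sqnormZ a f : L2 mu f -> sqnorm mu (fun x => a * f x) = normsq a * sqnorm mu f.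
Proof.
move=> Lf; rewrite /sqnorm -RintegralZl//; last exact: L2_integrable.
by apply: eq_Rintegral => x _; rewrite normsqM.
Qed.

Lemma sqnormBC f g : sqnorm mu (fun x => f x - g x) = sqnorm mu (fun x => g x - f x).
Proof. by apply: eq_Rintegral => x _; rewrite -normsqN opprB. Qed.

Variable V : set (T -> R[i]).
Hypotheses (sV : subspace V) (VL : V `<=` L2 mu).

Lemma L2closureP f : L2closure mu V f <->
  L2 mu f /\ forall e : R, 0 < e -> exists2 g, V g & sqnorm mu (fun x => f x - g x) < e.
Proof.
split=> -[Lf h]; split => // e e0.
  have s0 : 0 < Num.sqrt e by rewrite sqrtr_gt0.
  have [g [Vg Lg]] := h _ s0; rewrite L2norm_lt// sqr_sqrtr ?ltW// => ge.
  by exists g.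
have [g Vg ge] := h _ (exprn_gt0 2 e0).
by exists g; split => //; [exact: VL|rewrite L2norm_lt].
Qed.

Lemma L2closure_near f : L2 mu f ->
  (forall e : R, 0 < e -> exists2 g, L2closure mu V g & sqnorm mu (fun x => f x - g x) < e) ->
  L2closure mu V f.
Proof.
move=> Lf h; apply/L2closureP; split => // e e0.
have e4 : 0 < e / 4 by rewrite divr_gt0.
have [g /L2closureP[Lg gV] ge] := h _ e4; have [k Vk ke] := gV _ e4.
exists k => //; have sL := subspaceL2 mu; have Lk := VL Vk.
rewrite (_ : (fun x => _) = fun x => (f x - g x) + (g x - k x)); last first.
  by apply/funext => x; rewrite addrA subrK.
have := sqnormD (subspaceB sL Lf Lg) (subspaceB sL Lg Lk).
by move=> /le_lt_trans; apply; lra.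
Qed.

Lemma sub_L2closure : V `<=` L2closure mu V.
Proof.
move=> f Vf; apply/L2closureP; split; first exact: VL.
move=> e e0; exists f => //; rewrite (_ : sqnorm _ _ = 0)//.
rewrite /sqnorm (@eq_Rintegral _ _ _ _ _ (cst 0)) ?Rintegral_cst ?mul0r// => x _.
by rewrite subrr normsq0.
Qed.

Lemma subspace_L2closure : subspace (L2closure mu V).
Proof.
have sL := subspaceL2 mu.
split; first by apply: sub_L2closure; exact: sV.1.
move=> a f g /L2closureP[Lf fV] /L2closureP[Lg gV]; apply/L2closureP.
split; first exact: sL.2.
move=> e e0; have a1 : 0 < normsq a + 1 by rewrite ltr_wpDl// normsq_ge0.
have [f' Vf' fe] := fV (e / 4 / (normsq a + 1)) (divr_gt0 (divr_gt0 e0 (ltr0n _ 4)) a1).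
have [g' Vg' ge] := gV (e / 4) (divr_gt0 e0 (ltr0n _ 4)).
exists (fun x => a * f' x + g' x); first exact: sV.2.
rewrite (_ : (fun x => _) = fun x => a * (f x - f' x) + (g x - g' x)); last first.
  by apply/funext => x; ring.
have Lff := subspaceB sL Lf (VL Vf'); have Lgg := subspaceB sL Lg (VL Vg').
have := sqnormD (subspaceZ a sL Lff) Lgg; rewrite sqnormZ//.
move=> /le_lt_trans; apply.
rewrite ltr_pdivlMr// in fe.
have : normsq a * sqnorm mu (fun x => f x - f' x) <=
    sqnorm mu (fun x => f x - f' x) * (normsq a + 1).
  by rewrite mulrC ler_wpM2l ?sqnorm_ge0// lerDl.
lra.
Qed.

(** Dominated convergence of the squared distances. *)
Lemma L2closure_dominated (f_ : nat -> T -> R[i]) f (h : T -> R) :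
  (forall k, L2closure mu V (f_ k)) -> L2 mu f -> mu.-integrable setT (EFin \o h) ->
  {ae mu, forall x, (forall k, normsq (f_ k x - f x) <= h x) /\
      normsq (f_ k x - f x) @[k --> \oo] --> 0} ->
  L2closure mu V f.
Proof.
move=> cf Lf ih fh; apply: L2closure_near => // e e0.
have sL := subspaceL2 mu.
have Lfk k : L2 mu (fun x => f_ k x - f x) by apply: subspaceB => //; have [] := cf k.
have mfk k := measurable_int mu (L2_integrable (Lfk k)).
have [||_ _] := @dominated_convergence _ T R mu setT measurableT
  (fun k x => (normsq (f_ k x - f x))%:E) (cst 0%E) (EFin \o h) mfk (measurable_cst _) _ ih.
- apply: filterS fh => x [_ fx] _; apply/fine_cvgP; split; [exact: nearW|exact: fx].
- apply: filterS fh => x [hx _] k _.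
  by rewrite /= ger0_norm ?normsq_ge0// lee_fin.
rewrite /= integral0 => /fine_cvgP[_ /cvgr_lt/(_ e e0)] [k _ /(_ k (leqnn k))] /= ke.
by exists (f_ k) => //; rewrite sqnormBC.
Qed.

End Closure.

Section RealPart.
Context d (T : measurableType d) (R : realType) (mu : {measure set T -> \bar R}).
Hypothesis fin : (mu setT < +oo)%E.
Variable V : set (T -> R[i]).
Hypotheses (sV : subspace V) (VL : V `<=` L2 mu).
Implicit Types (u v : T -> R).

Lemma integrable_cst (c : R) : mu.-integrable setT (EFin \o (fun=> c)).
Proof.
apply/integrableP; split; first exact/measurable_EFinP.
rewrite (_ : (fun x => _) = cst (`|c|%:E)) // integral_cst//.
by rewrite lte_mul_pinfty// lee_fin.
Qed.

Lemma measurable_cplx u : measurable_fun setT u ->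
  measurable_fun setT (fun x => complex.Re (cplx u x)) /\
  measurable_fun setT (fun x => complex.Im (cplx u x)).
Proof. by move=> mu_; split; [exact: mu_|exact: measurable_cst]. Qed.

Lemma L2_bounded u (M : R) : measurable_fun setT u ->
  {ae mu, forall x, u x ^+ 2 <= M} -> L2 mu (cplx u).
Proof.
move=> mu_ uM; have [mr mi] := measurable_cplx mu_; split => //.
have mu2 : measurable_fun setT (fun x => (normsq (cplx u x))%:E).
  by apply/measurable_EFinP; exact: measurable_normsq.
have /integrableP[_ IM] := integrable_cst M.
apply: le_lt_trans IM; apply: ae_ge0_le_integral => //.
- by move=> x _; rewrite lee_fin normsq_ge0.
- apply: filterS uM => x uM _ /=; rewrite lee_fin normsq_cplx.
  exact: le_trans uM (ler_norm _).
Qed.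

Lemma L2_indic (A : set T) : measurable A -> L2 mu (cplx \1_A).
Proof.
move=> mA; apply: (@L2_bounded _ 1); first exact: measurable_indic.
by apply: aeW => x; rewrite indicE; case: (_ \in _); rewrite ?expr1n ?expr0n.
Qed.

Lemma L2closure_cplxD u v : L2closure mu V (cplx u) -> L2closure mu V (cplx v) ->
  L2closure mu V (cplx (fun x => u x + v x)).
Proof.
move=> cu cv; have := subspaceD (subspace_L2closure sV VL) cu cv.
by congr (L2closure _ _ _); apply/funext => x; apply: complexP; rewrite !partsE /= ?addr0.
Qed.

Lemma L2closure_cplxZ (c : R) u : L2closure mu V (cplx u) ->
  L2closure mu V (cplx (fun x => c * u x)).
Proof.
move=> cu; have := subspaceZ (Complex c 0) (subspace_L2closure sV VL) cu.
by congr (L2closure _ _ _); apply/funext => x; apply: complexP;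
  rewrite !partsE /= ?mulr0 ?mul0r ?subr0 ?addr0.
Qed.

Lemma L2closure_cplx_sum n (c : 'I_n -> R) (u : 'I_n -> T -> R) :
  (forall i, L2closure mu V (cplx (u i))) ->
  L2closure mu V (cplx (fun x => \sum_i c i * u i x)).
Proof.
move=> cu; have := subspace_sum (fun i => Complex (c i) 0) (subspace_L2closure sV VL) cu.
congr (L2closure _ _ _); apply/funext => x; apply: complexP => /=.
  by rewrite Re_sum; apply: eq_bigr => i _; rewrite !partsE /= mul0r subr0.
by rewrite Im_sum big1// => i _; rewrite !partsE /= mulr0 mul0r addr0.
Qed.

(** The sets with indicator in the closure form a Dynkin system: complements
    come from subtraction, disjoint unions from dominated convergence. *)
Lemma L2closure_indic (G : set (set T)) : @measurable _ T = <<s G >> -> setI_closed G ->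
  L2closure mu V (cplx (fun=> 1)) -> (forall A, G A -> L2closure mu V (cplx \1_A)) ->
  forall A, measurable A -> L2closure mu V (cplx \1_A).
Proof.
move=> mG GI c1 cG A; rewrite mG.
apply: (@dynkin_induction _ T G (fun A => L2closure mu V (cplx \1_A)) mG GI) => //.
- by rewrite indicT.
- move=> S mS cS; have := L2closure_cplxD c1 (L2closure_cplxZ (-1) cS).
  congr (L2closure _ _ (cplx _)); apply/funext => x; rewrite !indicE in_setC.
  by case: (_ \in _); rewrite /= ?mulr1 ?mulr0 ?addrN ?addr0.
move=> F mF tF cF.
pose s k x : R := \sum_(i < k) 1 * \1_(F i) x.
have sE j x k : F j x -> s k x = (j < k)%:R.
  move=> Fjx; case: ltnP => [jk|kj].
    rewrite /s (bigD1 (Ordinal jk))//= mul1r indicE mem_set// big1 ?addr0// => i ij.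
    rewrite mul1r indicE memNset// => Fix.
    have ijE := tF i j I I (ex_intro _ x (conj Fix Fjx)).
    by move: ij; rewrite -val_eqE /= ijE eqxx.
  rewrite /s big1// => i _; rewrite mul1r indicE memNset// => Fix.
  have ijE := tF i j I I (ex_intro _ x (conj Fix Fjx)).
  by have := ltn_ord i; rewrite ijE ltnNge kj.
apply: (L2closure_dominated VL (f_ := fun k => cplx (s k)) (h := fun=> 1)).
- by move=> k; exact: L2closure_cplx_sum.
- by apply: L2_indic; exact: bigcup_measurable.
- exact: integrable_cst.
apply: aeW => x; have [[j _ Fjx]|nF] := pselect ((\bigcup_k F k) x).
  split=> [k|]; rewrite /cplx indicE mem_set; try by exists j.
    by rewrite (sE _ _ _ Fjx) normsq_cplxB; case: (j < k)%N;
      rewrite ?subrr ?sub0r ?sqrrN ?expr0n ?expr1n.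
  apply: cvg_near_cst; near=> k; rewrite (sE _ _ _ Fjx) normsq_cplxB.
  by rewrite (_ : (j < k)%N = true) ?subrr ?expr0n//; near: k; exact: nbhs_infty_gt.
have s0 k : s k x = 0.
  rewrite /s big1// => i _; rewrite mul1r indicE memNset// => Fix.
  by apply: nF; exists i.
split=> [k|]; rewrite /cplx indicE memNset//.
  by rewrite normsq_cplxB s0 subrr expr0n.
by under eq_fun do rewrite normsq_cplxB s0 subrr expr0n; exact: cvg_cst.
Unshelve. all: by end_near. Qed.

Hypothesis cI : forall A, measurable A -> L2closure mu V (cplx \1_A).

Lemma L2closure_nneg u : measurable_fun setT u -> (forall x, 0 <= u x) -> L2 mu (cplx u) ->
  L2closure mu V (cplx u).
Proof.
move=> mu_ u0 Lu.
have mue : measurable_fun setT (EFin \o u) by exact/measurable_EFinP.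
have ue0 x : setT x -> (0%R <= (EFin \o u) x)%E by move=> _; rewrite lee_fin.
pose s := nnsfun_approx measurableT mue.
have scvg x : s k x @[k --> \oo] --> u x.
  by have := cvg_nnsfun_approx measurableT mue ue0 (I : setT x) => /fine_cvgP[].
have sle k x : s k x <= u x.
  rewrite -lee_fin /s nnsfun_approxE; exact: (le_approx k ue0).
apply: (L2closure_dominated VL (f_ := fun k => cplx (s k))
  (h := fun x => normsq (cplx u x))) => //.
- move=> k; have E := congr1 cplx (funext (fimfunEord (s k))).
  rewrite -[cplx (s k)]/(cplx (fun x => s k x)) E.
  by apply: L2closure_cplx_sum => i; apply: cI; exact: measurable_sfunP.
- exact: L2_integrable.
apply: aeW => x; split=> [k|].
  rewrite normsq_cplxB normsq_cplx -sqrrN opprB ler_sqr ?nnegrE ?subr_ge0//.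
  by rewrite gerBl; exact: fun_ge0.
under eq_fun do rewrite normsq_cplxB.
have h : (s k x - u x) @[k --> \oo] --> u x - u x by apply: cvgB => //; exact: cvg_cst.
have : (s k x - u x) ^+ 2 @[k --> \oo] --> (u x - u x) ^+ 2.
  exact: (cvgM h h).
by rewrite subrr expr0n.
Qed.

Lemma L2closure_real u : measurable_fun setT u -> L2 mu (cplx u) -> L2closure mu V (cplx u).
Proof.
move=> mu_ Lu.
(* u = (|u| + u) - |u| is a difference of nonnegative functions *)
pose a x : R := `|u x| + u x.
pose b x : R := `|u x|.
have mb : measurable_fun setT b by exact: measurableT_comp.
have Lb : L2 mu (cplx b).
  have [mr mi] := measurable_cplx mb; apply: L2_intro => //.
  have := L2_integrable Lu; congr (integrable _ _ (EFin \o _)).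
  by apply/funext => x; rewrite !normsq_cplx /b real_normK// num_real.
have La : L2 mu (cplx a).
  have := subspaceD (subspaceL2 mu) Lb Lu; congr (L2 _ _).
  by apply/funext => x; apply: complexP; rewrite !partsE /= ?addr0.
have ca : L2closure mu V (cplx a).
  apply: L2closure_nneg => //; first by rewrite /a; exact: measurable_funD.
  by move=> x; rewrite /a; have := ler_norm (- u x); rewrite normrN; lra.
have cb : L2closure mu V (cplx b) by apply: (L2closure_nneg mb _ Lb) => x; exact: normr_ge0.
have := L2closure_cplxD ca (L2closure_cplxZ (-1) cb).
congr (L2closure _ _ (cplx _)); apply/funext => x.
by rewrite /a /b; ring.
Qed.

Lemma L2closure_full : L2closure mu V = L2 mu.
Proof.
apply/seteqP; split => f; first by case.
move=> Lf; have [mr mi _] := Lf; have If := L2_integrable Lf.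
have key u : measurable_fun setT u -> (forall x, u x ^+ 2 <= normsq (f x)) ->
    L2closure mu V (cplx u).
  move=> mu_ uf; apply: L2closure_real => //.
  have [ur ui] := measurable_cplx mu_; apply: L2_intro => //.
  apply: le_integrable If => //; first by apply/measurable_EFinP; exact: measurable_normsq.
  by move=> x _; rewrite /= lee_fin !ger0_norm ?normsq_ge0 ?normsq_cplx.
have cr : L2closure mu V (cplx (fun x => complex.Re (f x))).
  by apply: key => // x; rewrite /normsq lerDl sqr_ge0.
have ci : L2closure mu V (cplx (fun x => complex.Im (f x))).
  by apply: key => // x; rewrite /normsq lerDr sqr_ge0.
have := (subspace_L2closure sV VL).2 (Complex 0 1) _ _ ci cr.
congr (L2closure _ _ _); apply/funext => x.
by apply: complexP; rewrite !partsE /=; ring.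
Qed.
End RealPart.

(** * Polynomial approximation of a step *)

Section StepPolynomial.
Context {R : realType}.
Implicit Types (y r : R).

Lemma bernoulli_lower y m : 0 <= y <= 1 -> 1 - m%:R * y <= (1 - y) ^+ m.
Proof.
move=> /andP[y0 y1]; elim: m => [|m IH]; first by rewrite mul0r subr0 expr0.
rewrite exprSr; apply: (@le_trans _ _ ((1 - m%:R * y) * (1 - y))); last first.
  by rewrite ler_wpM2r// subr_ge0.
have : 0 <= m%:R * y * y by rewrite !mulr_ge0.
rewrite -natr1; lra.
Qed.

Lemma bernoulli_upper y m : 0 <= y <= 1 -> (1 - y) ^+ m * (1 + m%:R * y) <= 1.
Proof.
move=> /andP[y0 y1]; elim: m => [|m IH]; first by rewrite mul0r addr0 expr0 mulr1.
apply: le_trans IH; rewrite exprSr -mulrA ler_wpM2l ?exprn_ge0 ?subr_ge0//.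
have : 0 <= m%:R * y * y by rewrite !mulr_ge0.
have := sqr_ge0 y; rewrite expr2 -natr1; lra.
Qed.

(** Bernoulli, in the form r ^+ k * (1 + k * (1 - r)) <= 1. *)
Lemma natmul_expr_le r k : 0 <= r < 1 -> k%:R * r ^+ k <= (1 - r)^-1.
Proof.
move=> /andP[r0 r1]; have r1' : 0 < 1 - r by rewrite subr_gt0.
rewrite -[leRHS]mul1r ler_pdivlMr//.
suff : r ^+ k * (1 + k%:R * (1 - r)) <= 1.
  by have : 0 <= r ^+ k; [exact: exprn_ge0|lra].
elim: k => [|k IH]; first by rewrite expr0 mul0r addr0 mulr1.
have h1 : r ^+ k.+1 <= 1 by rewrite exprn_ile1// ltW.
have h2 : r * (r ^+ k * (1 + k%:R * (1 - r))) <= r * 1 by rewrite ler_wpM2l.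
have h3 : r ^+ k.+1 * (1 - r) <= 1 * (1 - r) by rewrite ler_wpM2r// ltW.
rewrite -natr1 (_ : _ * _ = r * (r ^+ k * (1 + k%:R * (1 - r))) + r ^+ k.+1 * (1 - r)).
  lra.
by rewrite exprS; ring.
Qed.

Lemma cvg_natmul_expr r : 0 <= r < 1 -> k%:R * r ^+ k @[k --> \oo] --> 0.
Proof.
(* k * r ^+ k = (k * s ^+ k) * s ^+ k, where the first factor is bounded *)
move=> /andP[r0 r1]; pose s := Num.sqrt r.
have s0 : 0 <= s by exact: sqrtr_ge0.
have s1 : s < 1 by rewrite -(sqrtr1 R) ltr_sqrt.
have rE : r = s ^+ 2 by rewrite sqr_sqrtr.
apply: (@squeeze_cvgr _ _ _ _ (cst 0) (fun k => (1 - s)^-1 * s ^+ k)).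
- near=> k; rewrite mulr_ge0 ?exprn_ge0//=.
  rewrite rE -exprM mulnC exprM expr2 mulrA ler_wpM2r ?exprn_ge0//.
  by apply: natmul_expr_le; rewrite s0.
- exact: cvg_cst.
rewrite -[X in _ --> X](mulr0 (1 - s)^-1).
apply: cvgM; first exact: cvg_cst.
by apply: cvg_expr; rewrite ger0_norm.
Unshelve. all: by end_near. Qed.

(** With the factor k in the exponent, the limit at 1/2 is 0; the exponent
    2 ^ k alone would give the limit 1/e there. *)
Definition poly_step k y : R := (1 - y ^+ k) ^+ (k * 2 ^ k).

Lemma poly_step01 k y : 0 <= y <= 1 -> 0 <= poly_step k y <= 1.
Proof.
move=> /andP[y0 y1]; have h1 : y ^+ k <= 1 by exact: exprn_ile1.
have h0 : 0 <= y ^+ k by exact: exprn_ge0.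
by rewrite exprn_ge0 ?subr_ge0//= exprn_ile1// ?subr_ge0// gerBl.
Qed.

(** Bernoulli bounds 1 - poly_step k y by k * (2 * y) ^ k for y < 1/2, and
    poly_step k y by the inverse of 1 + k * (2 * y) ^ k for y >= 1/2. *)
Lemma cvg_poly_step y : 0 <= y <= 1 -> poly_step k y @[k --> \oo] --> ((y < 2^-1)%R%:R : R).
Proof.
move=> y01; have /andP[y0 y1] := y01.
have yk k : 0 <= y ^+ k <= 1 by rewrite exprn_ge0// exprn_ile1.
have mE k : (k * 2 ^ k)%:R * y ^+ k = k%:R * (2 * y) ^+ k.
  by rewrite natrM natrX exprMn mulrA.
case: ltP => [y2|y2].
  apply: (@squeeze_cvgr _ _ _ _ (fun k => 1 - k%:R * (2 * y) ^+ k) (cst 1)).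
  - near=> k; have /andP[_ ->] := poly_step01 k y01; rewrite andbT -mE.
    exact: bernoulli_lower.
  - rewrite -[X in _ --> X](subr0 1); apply: cvgB; first exact: cvg_cst.
    by apply: cvg_natmul_expr; lra.
  - exact: cvg_cst.
rewrite mulr0n; apply: (@squeeze_cvgr _ _ _ _ (cst 0) (fun k => (k.+1%:R : R)^-1)).
- near=> k; have /andP[-> _] := poly_step01 k y01; rewrite /= -[leRHS]mul1r ler_pdivlMr//.
  apply: le_trans (bernoulli_upper (k * 2 ^ k) (yk k)).
  have /andP[s0 _] := poly_step01 k y01; rewrite ler_wpM2l//.
  rewrite mE -natr1 addrC lerD2l -[leLHS]mulr1 ler_wpM2l//.
  by rewrite exprn_ege1//; lra.
- exact: cvg_cst.
- exact: cvg_harmonic.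
Unshelve. all: by end_near. Qed.
End StepPolynomial.

(** * Density of the polynomials *)

Section PolynomialDensity.
Context {R : realType} (G : carnotGroup R).
Local Notation n := (cg_dim G).
Variable N : pt G -> R.
Hypothesis gN : gauge N.
Implicit Types (u v : pt G -> R) (x y : pt G) (A B : set (pt G)).

Definition real_polynomial u := polynomial_fun (cplx u : pt G -> R[i]).

Lemma real_polynomial_cst (c : R) : real_polynomial (fun=> c).
Proof. by exists (mpoly.mpolyC n (Complex c 0)); apply/funext => x; rewrite mpoly.mevalC. Qed.

Lemma real_polynomial_coord i : real_polynomial (fun x => x 0 i).
Proof.
by exists (mpoly.mpolyX _ (mpoly.mnm1 i)); apply/funext => x; rewrite mpoly.mevalXU.
Qed.

Lemma real_polynomialD u v : real_polynomial u -> real_polynomial v ->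
  real_polynomial (fun x => u x + v x).
Proof.
move=> [p pE] [q qE]; exists (p + q); apply/funext => x.
rewrite mpoly.mevalD -[mpoly.meval _ p]/((fun x => mpoly.meval (complex_coords x) p) x) -pE.
rewrite -[mpoly.meval _ q]/((fun x => mpoly.meval (complex_coords x) q) x) -qE.
by apply: complexP; rewrite !partsE /= ?addr0.
Qed.

Lemma real_polynomialM u v : real_polynomial u -> real_polynomial v ->
  real_polynomial (fun x => u x * v x).
Proof.
move=> [p pE] [q qE]; exists (p * q); apply/funext => x.
rewrite mpoly.mevalM -[mpoly.meval _ p]/((fun x => mpoly.meval (complex_coords x) p) x) -pE.
rewrite -[mpoly.meval _ q]/((fun x => mpoly.meval (complex_coords x) q) x) -qE.
by apply: complexP; rewrite !partsE /= ?mulr0 ?mul0r ?subr0 ?addr0.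
Qed.

Lemma real_polynomialX u k : real_polynomial u -> real_polynomial (fun x => u x ^+ k).
Proof.
move=> pu; elim: k => [|k IH]; first exact: real_polynomial_cst.
by under eq_fun do rewrite exprS; exact: real_polynomialM.
Qed.

Lemma compact_sphere : compact (sphere N).
Proof.
have [_ pN _ _ _] := gN.
rewrite (_ : sphere N = N @^-1` [set 1]); last by apply/seteqP; split.
by apply: pN; exact: compact_set1.
Qed.

Lemma measurable_sphere : measurable (sphere N : set (borel G)).
Proof.
have [cN _ _ _ _] := gN.
have -> : sphere N = ~` (N @^-1` (~` [set 1])).
  by apply/seteqP; split => x /=; [move=> -> /=|move/contrapT].
apply: measurableC; apply: open_borel.
by move/continuousP : cN; apply; apply: closed_openC; exact: closed_eq.
Qed.

Lemma bounded_sphere u : continuous u ->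
  exists2 L : R, 0 < L & forall x, N x = 1 -> `|u x| <= L.
Proof.
move=> cu.
have [S0|S0] := pselect (sphere N !=set0); last first.
  by exists 1 => // x Nx; exfalso; apply: S0; exists x.
have cnu : continuous (fun x => `|u x|).
  exact: (continuous_comp_fun cu (@norm_continuous _ R)).
have [c _ cP] := compact_EVT_max S0 compact_sphere (continuous_subspaceT cnu).
exists (`|u c| + 1); first by rewrite ltr_wpDl.
by move=> x Nx; rewrite (le_trans (cP x _)) ?inE// lerDl.
Qed.

(** The bounds 0 and 1 serve twice: products of approximations approximate
    intersections, and dominated convergence applies on the sphere. *)
Definition approximable A := measurable (A : set (borel G)) /\
  exists p : nat -> pt G -> R, [/\ forall k, real_polynomial (p k),
    forall k x, N x = 1 -> 0 <= p k x <= 1 &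
    forall x, N x = 1 -> p k x @[k --> \oo] --> (\1_A x : R)].

Lemma approximableT : approximable setT.
Proof.
split; first exact: (@measurableT _ (borel G)).
exists (fun _ _ => 1); split; first by move=> _; exact: real_polynomial_cst.
  by move=> k x _; rewrite ler01 lexx.
by move=> x _; rewrite indicT; exact: cvg_cst.
Qed.

Lemma approximableI A B : approximable A -> approximable B -> approximable (A `&` B).
Proof.
move=> [mA [p [pp p01 pA]]] [mB [q [qq q01 qB]]].
split; first exact: (@measurableI _ (borel G)).
exists (fun k x => p k x * q k x); split.
- by move=> k; exact: real_polynomialM.
- move=> k x Nx; have /andP[p0 p1] := p01 k x Nx; have /andP[q0 q1] := q01 k x Nx.
  by rewrite mulr_ge0//= -[leRHS]mulr1 ler_pM.
- by move=> x Nx; rewrite indicI; exact: cvgM (pA x Nx) (qB x Nx).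
Qed.

(** The affine map l sends the values of u on the sphere into [0, 1], and 0 to
    the threshold 1/2 of the polynomial step. *)
Lemma approximable_lt0 u : real_polynomial u -> approximable [set x | u x < 0].
Proof.
move=> pu; have cu : continuous u by exact: (polynomial_continuous pu).1.
split.
  apply: open_borel; rewrite (_ : [set x | _] = u @^-1` `]-oo, 0[%classic).
    by move/continuousP : cu; apply; exact: interval_open.
  by apply/seteqP; split => x /=; rewrite in_itv.
have [L L0 uL] := bounded_sphere cu.
pose l x : R := 2^-1 + (L * 2)^-1 * u x.
have l01 x : N x = 1 -> 0 <= l x <= 1.
  move=> /uL; rewrite ler_norml => /andP[u1 u2].
  have h : -(2^-1) <= (L * 2)^-1 * u x <= 2^-1.
    rewrite mulrC ler_pdivrMr ?mulr_gt0// ler_pdivlMr ?mulr_gt0//.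
    by apply/andP; split; lra.
  by rewrite /l; lra.
exists (fun k x => poly_step k (l x)); split.
- move=> k; apply: real_polynomialX.
  under eq_fun do rewrite -mulN1r.
  apply: real_polynomialD; first exact: real_polynomial_cst.
  apply: real_polynomialM; first exact: real_polynomial_cst.
  apply: real_polynomialX; apply: real_polynomialD; first exact: real_polynomial_cst.
  by apply: real_polynomialM => //; exact: real_polynomial_cst.
- by move=> k x /l01; exact: poly_step01.
- move=> x Nx; have := cvg_poly_step (l01 x Nx); congr (_ --> _).
  rewrite indicE; congr ((nat_of_bool _)%:R).
  rewrite /l gtrDl pmulr_rlt0 ?invr_gt0 ?mulr_gt0//.
  by apply/idP/idP; rewrite inE.
Qed.

Lemma approximable_seq (s : seq 'I_n) (B : 'I_n -> set (pt G)) :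
  (forall i, approximable (B i)) -> approximable [set x | forall i, i \in s -> B i x].
Proof.
move=> aB; elim: s => [|i s IH].
  by rewrite (_ : [set x | _] = setT); [exact: approximableT|apply/seteqP; split].
rewrite (_ : [set x | _] = B i `&` [set x | forall i, i \in s -> B i x]).
  exact: approximableI.
apply/seteqP; split => x /= h.
  split; first by apply: h; rewrite mem_head.
  by move=> j js; apply: h; rewrite inE js orbT.
by move=> j; rewrite inE => /predU1P[->|]; [have [] := h|apply: h.2].
Qed.

Definition box (q : pt G) (e : R) : set (pt G) :=
  [set x | forall i, q 0 i - e < x 0 i < q 0 i + e].

Lemma approximable_box q e : approximable (box q e).
Proof.
rewrite (_ : box q e = [set x | forall i, i \in enum 'I_n ->
   ([set x | x 0 i - (q 0 i + e) < 0] `&` [set x | (q 0 i - e) - x 0 i < 0]) x]).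
  apply: approximable_seq => i; apply: approximableI; apply: approximable_lt0.
    by apply: real_polynomialD; [exact: real_polynomial_coord|exact: real_polynomial_cst].
  rewrite (_ : (fun x => _) = fun x => (q 0 i - e) + (-1) * x 0 i); last first.
    by apply/funext => x; rewrite mulN1r.
  apply: real_polynomialD; first exact: real_polynomial_cst.
  by apply: real_polynomialM; [exact: real_polynomial_cst|exact: real_polynomial_coord].
apply/seteqP; split => x /= h i.
  by move=> _; have /andP[h1 h2] := h i; rewrite !subr_lt0.
by have := h i (mem_enum _ i); rewrite !subr_lt0 => -[-> ->].
Qed.

(** An open set is the union of the boxes of rational center and radius
    1 / (k + 1) which it contains. *)
Lemma open_approximable A : open A -> <<s approximable >> A.
Proof.
move=> oA.
pose F k : set (pt G) := if unpickle k is Some z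
  then let e := ((z : 'rV[rat]_n * nat).2.+1%:R : R)^-1 in
       if pselect (box (map_mx ratr z.1) e `<=` A) then box (map_mx ratr z.1) e else set0
  else set0.
suff -> : A = \bigcup_k F k.
  apply: sigma_algebra_bigcup => k; rewrite /F; case: unpickle => [z|].
    case: pselect => ?; first by apply: sub_sigma_algebra; exact: approximable_box.
    by have [] := @smallest_sigma_algebra _ setT approximable.
  by have [] := @smallest_sigma_algebra _ setT approximable.
apply/seteqP; split => x; last first.
  move=> [k _]; rewrite /F; case: unpickle => [z|//].
  by case: pselect => // h; exact: h.
move=> Ax; have /nbhs_ballP[e /= e0 eA] := open_nbhs_nbhs (conj oA Ax).
have [k] := ltr_add_invr (divr_gt0 e0 (ltr0n R 2)); rewrite add0r => ke.
set d := (k.+1%:R)^-1 in ke.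
have d0 : 0 < d by rewrite invr_gt0.
have [|q] := @rational_point R G _ (open_interior (ball x d)).
  by exists x; exact: nbhsx_ballx.
move=> /interior_subset [_ qx].
have box_x : box (map_mx ratr q) d x.
  move=> i; have := qx 0 i; rewrite /ball /= ltr_distlC => /andP[h1 h2].
  by apply/andP; split; lra.
have box_A : box (map_mx ratr q) d `<=` A.
  move=> y yq; apply: eA; split => // a i; rewrite ord1 /ball /= ltr_norml.
  have /andP[h1 h2] := yq i; have /andP[h3 h4] := box_x i.
  by apply/andP; split; lra.
exists (pickle (q, k)) => //; rewrite /F pickleK /=.
by case: pselect.
Qed.

Lemma measurable_approximable :
  @measurable _ (borel G) = <<s approximable >>.
Proof.
apply/seteqP; split; last first.
  apply: smallest_sub; first exact: sigma_algebra_measurable.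
  by move=> A [].
apply: smallest_sub; first exact: smallest_sigma_algebra.
exact: open_approximable.
Qed.

Variable sigma : {finite_measure set (borel G) -> \bar R}.
Hypothesis sigmaS : sigma (~` sphere N) = 0%E.

Lemma ae_sphere : {ae sigma, forall x, sphere N x}.
Proof.
exists (~` sphere N); split => //.
by apply: measurableC; exact: measurable_sphere.
Qed.

Lemma sigma_fin : (sigma setT < +oo)%E.
Proof. by rewrite -ge0_fin_numE// fin_num_measure. Qed.

Lemma L2_polynomial (p : pt G -> R[i]) : polynomial_fun p -> L2 sigma p.
Proof.
move=> pp; have [cr ci] := polynomial_continuous pp.
have key u : continuous u -> L2 sigma (cplx u : borel G -> R[i]).
  move=> cu; have [L L0 uL] := bounded_sphere cu.
  apply: (@L2_bounded _ _ _ sigma sigma_fin _ (L ^+ 2)); first exact: continuous_borel.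
  apply: (@filterS _ _ (ae_filter_ringOfSetsType sigma) _ _ _ ae_sphere) => x /uL h.
  by rewrite -real_normK ?num_real// ler_sqr ?nnegrE// ltW.
have := (subspaceL2 sigma).2 (Complex 0 1) _ _ (key _ ci) (key _ cr).
congr (L2 _ _); apply/funext => x.
by apply: complexP; rewrite !partsE /=; ring.
Qed.

(** Indicators of approximable sets are limits of polynomials by dominated
    convergence, and these sets form a family, stable under intersection, that
    generates the Borel sets. *)
Lemma polynomial_dense (V : set (borel G -> R[i])) : subspace V -> V `<=` L2 sigma ->
  @polynomial_fun R G `<=` V -> L2closure sigma V = L2 sigma.
Proof.
move=> sV VL pV; apply: (L2closure_full sV VL).
apply: (L2closure_indic sigma_fin sV VL measurable_approximable).
- exact: approximableI.
- by apply: (sub_L2closure VL); apply: pV; exact: real_polynomial_cst.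
move=> A [mA [p [pp p01 pA]]].
apply: (L2closure_dominated VL (f_ := fun k => cplx (p k)) (h := fun=> 1)).
- by move=> k; apply: (sub_L2closure VL); apply: pV; exact: pp.
- exact: (L2_indic sigma_fin).
- exact: (integrable_cst sigma_fin).
apply: (@filterS _ _ (ae_filter_ringOfSetsType sigma) _ _ _ ae_sphere) => x Sx; split=> [k|].
  rewrite normsq_cplxB -real_normK ?num_real// expr_le1// ler_norml.
  have /andP[p0 p1] := p01 k x Sx.
  by rewrite indicE; case: (_ \in _) => /=; apply/andP; split; lra.
under eq_fun do rewrite normsq_cplxB.
have h : (p k x - \1_A x) @[k --> \oo] --> (\1_A x - \1_A x : R).
  by apply: cvgB; [exact: pA|exact: cvg_cst].
have : (p k x - \1_A x) ^+ 2 @[k --> \oo] --> (\1_A x - \1_A x : R) ^+ 2.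
  exact: (cvgM h h).
by rewrite subrr expr0n.
Qed.

End PolynomialDensity.

(** * The orthogonal decompositions *)

Section SphereFiltration.
Context {R : realType} (G : carnotGroup R) (N : pt G -> R)
  (sigma : {finite_measure set (borel G) -> \bar R}).
Hypotheses (gN : gauge N) (sigmaS : sigma (~` sphere N) = 0%E).
Variable A : nat -> set (pt G -> R[i]).
Hypotheses (sA : forall j, subspace (A j)) (AP : forall j, A j `<=` @Pm R G j).

Definition sphere_filtration (k : nat) : set (borel G -> R[i]) :=
  restr sigma (sphere N) (psum A k).
Local Notation F := sphere_filtration.

(** The measure sigma is carried by the sphere, so equality almost everywhere
    on the sphere is equality almost everywhere. *)
Lemma restrP B (f : borel G -> R[i]) : restr sigma (sphere N) B f <->
  L2 sigma f /\ exists2 p, B p & ae0 sigma (fun x => f x - p x).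
Proof.
split=> -[Lf [p Bp fp]]; split => //; exists p => //.
  apply: (@filterS2 _ _ (ae_filter_ringOfSetsType sigma) _ _ _ _ (ae_sphere gN sigmaS) fp).
  by move=> x Sx /(_ Sx) ->; rewrite subrr.
apply: (@filterS _ _ (ae_filter_ringOfSetsType sigma) _ _ _ fp) => x /eqP.
by rewrite subr_eq0 => /eqP.
Qed.

Lemma psum_polynomial k : psum A k `<=` @polynomial_fun R G.
Proof.
by apply: psum_sub (@subspace_polynomial R G) _ => j _ p /AP [].
Qed.

Lemma restr_psum k p : psum A k p -> F k p.
Proof.
move=> pk; apply/restrP; split; first exact: (L2_polynomial gN sigmaS (psum_polynomial pk)).
by exists p => //; apply: aeW => x; rewrite subrr.
Qed.

Lemma subspace_filtration k : subspace (F k).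
Proof.
have sP := subspace_psum k sA.
split; first by apply: restr_psum; exact: sP.1.
move=> a f g /restrP[Lf [p pk fp]] /restrP[Lg [q qk gq]]; apply/restrP.
split; first exact: (subspaceL2 sigma).2.
exists (fun x => a * p x + q x); first exact: sP.2.
have := (ae0_subspace sigma).2 a _ _ fp gq; congr (ae0 _ _).
by apply/funext => x; ring.
Qed.

Lemma filtration_ae_closed k : ae_closed sigma (F k).
Proof.
move=> f g /restrP[Lf [p pk fp]] Lg gf; apply/restrP; split => //; exists p => //.
have := subspaceD (ae0_subspace sigma) gf fp; congr (ae0 _ _).
by apply/funext => x; rewrite addrA subrK.
Qed.

Lemma filtration_fingen k : fingen sigma (F k).
Proof.
have sP := subspace_psum k sA.
have [|d [b [bP _ bS]]] := has_dim_finspan sP.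
  have [m [e eP]] := @finspan_size_le R G k.
  exists m, e => f [g [Ag fE]]; apply: eP; apply: psum_Pm_size_le.
  by exists g; split => // j jk; apply: AP; exact: Ag.
exists d, b; split; first by move=> i; exact: restr_psum.
move=> f /restrP[Lf [p pk fp]]; have [c cE] := bS p pk; exists c.
apply: (@filterS _ _ (ae_filter_ringOfSetsType sigma) _ _ _ fp) => x.
have /eqP := congr1 (@^~ x) cE; rewrite subr_eq0 => /eqP <-.
by [].
Qed.

Lemma filtrationS k : F k `<=` F k.+1.
Proof.
move=> f [Lf [p pk fp]]; split => //; exists p => //; exact: psumS.
Qed.

Lemma filtration0 : F 0%N `<=` ae0 sigma.
Proof.
move=> f /restrP[_ [p [g [_ ->]] fp]].
apply: (@filterS _ _ (ae_filter_ringOfSetsType sigma) _ _ _ fp) => x.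
by rewrite big_ord0 subr0.
Qed.

Lemma filtration_L2 k : F k `<=` L2 sigma.
Proof. by move=> f []. Qed.

Lemma hilbert_sum_sphere : hilbert_sum sigma
  (L2closure sigma (\bigcup_k F k.+1)) (fun m => F m.+1 `&` orth sigma (F m)).
Proof.
exact: (hilbert_sum_filtration subspace_filtration filtration_L2 filtration_fingen
  filtration_ae_closed filtrationS filtration0).
Qed.

End SphereFiltration.

Section MainResults.
Context {R : realType} (G : carnotGroup R) (N : pt G -> R)
  (mu : {measure set (borel G) -> \bar R})
  (sigma : {finite_measure set (borel G) -> \bar R}).
Variable X : 'M[R]_(layer_dim G 1, cg_dim G).
Hypotheses (bX : basis_V1 X) (hmu : haar mu) (gN : gauge N) (pol : polar_measure mu N sigma).
Let sigmaS : sigma (~` sphere N) = 0%E := pol.1.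

Let Hm_Pm j : Hm X j `<=` @Pm R G j.
Proof. by move=> p []. Qed.

Let FH := sphere_filtration N sigma (Hm X).

(** A function of the right-hand side differs from a sum of homogeneous
    harmonic polynomials by a null function r, which the last summand absorbs. *)
Lemma EspaceE k : Espace N sigma X k.+1 = FH k.+1.
Proof.
have sH := @subspace_Hm R G X.
apply/seteqP; split => f.
  apply: psum_sub; first exact: subspace_filtration gN sigmaS _ sH Hm_Pm _.
  move=> j jk g [Lg [p Hp gp]]; split => //; exists p => //.
  by apply: (psum_le sH jk); exact: psum_term.
move=> /(restrP gN sigmaS)[Lf [_ [h [Hh ->]] fh]].
have Lh j : (j < k.+1)%N -> L2 sigma (h j).
  by move=> jk; apply: (L2_polynomial gN sigmaS); have [[]] := Hh j jk.
pose r x := f x - \sum_(j < k.+1) h j x.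
exists (fun j => if j == k then fun x => h k x + r x else h j); split.
  move=> j jk; have hj := Hh j jk.
  have Ej : restr sigma (sphere N) (Hm X j) (h j).
    apply/(restrP gN sigmaS); split; first exact: Lh.
    by exists (h j) => //; apply: aeW => x; rewrite subrr.
  case: eqP => [jE|//]; apply/(restrP gN sigmaS); split.
    rewrite -jE; apply: (subspaceD (subspaceL2 sigma)); first exact: Lh.
    apply: (subspaceB (subspaceL2 sigma)) => //.
    rewrite (_ : (fun x => _) = fun x => \sum_(j < k.+1) 1 * h j x).
      by apply: (subspace_sum _ (subspaceL2 sigma)) => i; apply: Lh.
    by apply/funext => x; apply: eq_bigr => i _; rewrite mul1r.
  exists (h j) => //; rewrite jE; move: fh; congr (ae0 _ _).
  by apply/funext => x; rewrite addrAC subrr add0r.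
apply/funext => x; rewrite big_ord_recr /= eqxx.
under eq_bigr => j _ do rewrite (ltn_eqF (ltn_ord j)).
by rewrite /r big_ord_recr /=; ring.
Qed.

(** The two filtrations differ only at step 0, by null functions, and these
    are orthogonal to everything. *)
Lemma orth_Espace k : orth sigma (Espace N sigma X k) = orth sigma (FH k).
Proof.
case: k => [|k]; last by rewrite EspaceE.
apply/seteqP; split => f [Lf fo]; split => // g.
  move=> /[dup] /filtration_L2 Lg /(filtration0 gN sigmaS) g0.
  exact: orth_ae0.
move=> [h [_ ->]]; rewrite (_ : (fun x => _) = fun=> 0); first exact: inner0r.
by apply/funext => x; rewrite big_ord0.
Qed.

Lemma KspaceE m : Kspace N sigma X m = FH m.+1 `&` orth sigma (FH m).
Proof. by rewrite /Kspace EspaceE orth_Espace. Qed.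

Lemma hilbert_sum_Kspace : hilbert_sum sigma (HNspace N sigma X) (Kspace N sigma X).
Proof.
rewrite /HNspace (_ : \bigcup_m _ = \bigcup_m FH m.+1); last first.
  by apply: eq_bigcup => // k _; exact: EspaceE.
rewrite (_ : Kspace N sigma X = fun m => FH m.+1 `&` orth sigma (FH m)); last first.
  by apply/funext => m; exact: KspaceE.
exact: (hilbert_sum_sphere gN sigmaS (@subspace_Hm R G X) Hm_Pm).
Qed.

(** A continuous function that is null on the sphere vanishes there, by the
    full support of sigma. *)
Lemma Hm_direct_ae k (h : nat -> pt G -> R[i]) : (forall j, (j < k)%N -> Hm X j (h j)) ->
  ae0 sigma (fun x => \sum_(j < k) h j x) -> forall j, (j < k)%N -> h j = fun=> 0.
Proof.
move=> Hh h0; apply: (Hm_direct_sphere bX gN Hh) => x Nx; apply: normsq_eq0.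
have hp : polynomial_fun (fun x => \sum_(j < k) h j x).
  by apply: (@psum_polynomial _ _ _ Hm_Pm k); exists h.
have [cr ci] := polynomial_continuous hp.
apply: (polar_full_support hmu gN pol (psi := fun x => normsq (\sum_(j < k) h j x)) _ _ _ Nx).
- move=> y; exact: (continuousD (continuousM (cr y) (cr y)) (continuousM (ci y) (ci y))).
- by move=> y; exact: normsq_ge0.
apply: (@filterS _ _ (ae_filter_ringOfSetsType sigma) _ _ _ h0) => y -> _.
exact: normsq0.
Qed.

(** A basis of Hm X m generates step m + 1 of the filtration modulo step m,
    and it is independent there because the sum of the Hm X j is direct on the
    sphere. *)
Lemma dim_Kspace m : exists k : nat,
  has_dim (ae0 sigma) (Kspace N sigma X m) k /\ has_dim [set fun=> 0] (Hm X m) k.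
Proof.
have sH := @subspace_Hm R G X.
have [|k Hk] := has_dim_finspan (sH m).
  have [d [e eP]] := @finspan_size_le R G m.+1.
  by exists d, e => f /Hm_Pm/Pm_size_le; exact: eP.
exists k; split => //; rewrite KspaceE; have [b [Hb bI bS]] := Hk.
have sF := subspace_filtration gN sigmaS sH Hm_Pm.
have Fb i : FH m.+1 (b i).
  by apply: (restr_psum gN sigmaS Hm_Pm); exact: psum_term.
apply: (has_dim_increment sF (@filtration_L2 _ _ _ _ _) (filtration_fingen gN sigmaS sH Hm_Pm)
  (filtrationS sH) (h := b) Fb).
- move=> f /(restrP gN sigmaS)[Lf [_ [h [Hh ->]] fh]].
  have [c cE] := bS (h m) (Hh m (ltnSn m)).
  exists c; exists (fun x => \sum_(j < m) h j x).
    apply: (restr_psum gN sigmaS Hm_Pm); exists h; split => // j jm.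
    by apply: Hh; exact: ltnW.
  move: fh; congr (ae0 _ _); apply/funext => x; rewrite big_ord_recr /=.
  have /eqP := congr1 (@^~ x) cE; rewrite subr_eq0 => /eqP ->.
  by rewrite opprD addrA addrAC.
move=> c g /(restrP gN sigmaS)[Lg [_ [h [Hh ->]] gh]] cg.
pose q x := \sum_i c i * b i x.
have Hq : Hm X m q by exact: subspace_sum.
have q0 : q = fun=> 0.
  pose h' j := if j == m then q else fun x => (-1) * h j x.
  have h'E j : (j < m)%N -> h' j = fun x => (-1) * h j x by move=> jm; rewrite /h' ltn_eqF.
  have h'm : h' m = q by rewrite /h' eqxx.
  rewrite -h'm; apply: (Hm_direct_ae (k := m.+1) (h := h') _ _ (ltnSn m)).
    move=> j; rewrite /h' ltnS leq_eqVlt; case: eqP => [-> //|_ /= jm].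
    exact: (subspaceZ (-1) (sH j) (Hh j jm)).
  have := subspaceD (ae0_subspace sigma) cg gh; congr (ae0 _ _).
  apply/funext => x; rewrite [RHS]big_ord_recr /= h'm.
  rewrite (_ : \sum_(j < m) h' j x = \sum_(j < m) (-1) * h j x); last first.
    by apply: eq_bigr => j _; rewrite h'E.
  by rewrite -mulr_sumr /q; ring.
by move=> i; apply: bI; exact: q0.
Qed.

Lemma L2_Vspace : L2closure sigma (\bigcup_k Vspace N sigma k.+1) = L2 sigma.
Proof.
have sP := @subspace_Pm R G.
have sF := subspace_filtration gN sigmaS sP (fun j => @subset_refl _ (@Pm R G j)).
have FS := @filtrationS _ _ N sigma _ sP.
apply: (polynomial_dense gN sigmaS).
- split; first by exists 0%N => //; exact: (sF 1%N).1.
  move=> a f g [j _ fj] [k _ gk]; exists (maxn j k) => //.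
  apply: (sF _).2; [apply: (filtration_le FS _ fj)|apply: (filtration_le FS _ gk)];
    by rewrite ltnS (leq_maxl, leq_maxr).
- by move=> f [k _ []].
- move=> p /polynomial_psum[k pk]; exists k => //.
  by apply: FS; apply: (restr_psum gN sigmaS) pk => j.
Qed.

Lemma hilbert_sum_Wspace : hilbert_sum sigma (L2 sigma) (Wspace N sigma).
Proof.
rewrite -L2_Vspace.
exact: (hilbert_sum_sphere gN sigmaS (@subspace_Pm R G) (fun j => @subset_refl _ (@Pm R G j))).
Qed.

End MainResults.

Theorem theorem1p4 (R : realType) (G : carnotGroup R)
    (X : 'M[R]_(layer_dim G 1, cg_dim G))
    (mu : {measure set (borel G) -> \bar R})
    (N : pt G -> R) (sigma : {finite_measure set (borel G) -> \bar R}) :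
  basis_V1 X -> haar mu -> gauge N -> polar_measure mu N sigma ->
  [/\ hilbert_sum sigma (HNspace N sigma X) (Kspace N sigma X),
      forall m : nat, exists k : nat,
        has_dim (ae0 sigma) (Kspace N sigma X m) k /\
        has_dim [set (fun _ => 0)] (Hm X m) k,
      hilbert_sum sigma (L2 sigma) (Kspace N sigma X) <->
        HNspace N sigma X = L2 sigma &
      hilbert_sum sigma (L2 sigma) (Wspace N sigma)].
Proof.
move=> bX hmu gN pol.
have HK : hilbert_sum sigma (HNspace N sigma X) (Kspace N sigma X).
  exact: hilbert_sum_Kspace gN pol.
split => //.
- by move=> m; exact: dim_Kspace bX hmu gN pol m.
- split=> [[_ _ ->]|<- //].
  by have [_ _ ->] := HK.
- exact: hilbert_sum_Wspace gN pol.
Qed.
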